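(* Let $p \geq 2$ be an integer, let $\Omega$ be an open subset of $\mathbb{R}^d$, and let $f:\Omega \to \mathbb{R}$ be a non-negative function of class $C^p$ with zero set $\mathcal{Z} = \{x \in \Omega : f(x) = 0\}$. Assume that $f$ satisfies the global normal Hessian condition, i.e. $f$ satisfies the normal Hessian condition at every point $x_0 \in \mathcal{Z}$. Then there exists an at most countable index set $I$ and a family $(f_i)_{i \in I}$ of functions $f_i \in C^{p-2}(\Omega)$ with locally finite support such that \[ \forall x \in \Omega,\quad f(x) = \sum_{i \in I} f_i(x)^2. \] Moreover: (1) if $f$ satisfies the strict Hessian condition, i.e. $\nabla^2 f(x_0)$ is positive definite for every $x_0 \in \mathcal{Z}$, then $\mathcal{Z}$ is discrete and such a decomposition can be found with $|I| \leq d+1$; (2) if $\mathcal{Z}$ is compact, then $I$ can be taken to be finite.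
   Context: A subset $N \subset \mathbb{R}^d$ is a sub-manifold of $\mathbb{R}^d$ of class $C^k$ ($k \geq 1$) if for every $x \in N$ there is an integer $d_x$, an open neighborhood $U$ of $0$ in $\mathbb{R}^{d_x}$, an open set $V \subset \mathbb{R}^d$ and a $C^k$ map $\phi: U \to \mathbb{R}^d$ with $\phi(0)=x$, $\phi(U) = N \cap V$, $\phi: U \to \phi(U)$ a homeomorphism, and $d\phi(0)$ injective; $d_x$ is the dimension of $N$ at $x$ and $T_xN = d\phi(0)(\mathbb{R}^{d_x})$ is the tangent space. A non-negative $C^p$ function $f$ ($p\ge 2$) defined on an open neighborhood of $x_0 \in \mathbb{R}^d$ with $f(x_0)=0$ satisfies the normal Hessian condition (NHC) at $x_0$ if there exist $0 \leq d_0 \leq d$ and a sub-manifold $N$ of $\mathbb{R}^d$ of class $C^k$ for some $k \geq 1$ and of dimension $d_0$ with $x_0 \in N \subset \mathcal{Z}$ (the zero set of $f$), such that the rank of the Hessian matrix $\nabla^2 f(x_0)$ equals $d - d_0$ (equivalently, the restriction of $d^2 f(x_0)$ to the orthogonal complement $(T_{x_0}N)^{\perp}$ is positive definite). A family $(f_i)_{i\in I}$ of functions on a topological space $X$ has locally finite support if every $x \in X$ has an open neighborhood meeting only finitely many of the sets $\mathrm{supp}(f_i) = \overline{\{y : f_i(y) \neq 0\}}$. *)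

(* Defs.v *)
From HB Require Import structures.
From mathcomp Require Import all_boot all_order all_algebra.
From mathcomp Require Import all_classical all_reals all_analysis.
Set Implicit Arguments. Unset Strict Implicit. Unset Printing Implicit Defensive.
Import Order.TTheory GRing.Theory Num.Theory.
Import numFieldNormedType.Exports.
Local Open Scope classical_set_scope.
Local Open Scope ring_scope.

Section Defs.
Variable R : realType.

Definition basis_vec (n : nat) (j : 'I_n) : 'rV[R]_n := delta_mx 0 j.

Definition partial (n : nat) (W : normedModType R) (j : 'I_n)
  (f : 'rV[R]_n -> W) : 'rV[R]_n -> W :=
  fun x => derive f x (basis_vec j).

Fixpoint Ck (k : nat) (n : nat) (W : normedModType R) (U : set 'rV[R]_n)
  (f : 'rV[R]_n -> W) : Prop :=
  (forall x, U x -> {for x, continuous f}) /\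
  match k with
  | 0%N => True
  | k'.+1 => (forall x, U x -> forall j : 'I_n, derivable f x (basis_vec j)) /\
             (forall j : 'I_n, Ck k' U (partial j f))
  end.

Definition hessian (n : nat) (f : 'rV[R]_n -> R) (x : 'rV[R]_n) : 'M[R]_n :=
  \matrix_(i < n, j < n) partial i (partial j f) x.

Definition posdef (n : nat) (H : 'M[R]_n) : Prop :=
  forall v : 'rV[R]_n, v != 0 -> 0 < (v *m H *m v^T) 0 0.

Definition submanifold (d k m : nat) (N : set 'rV[R]_d) : Prop :=
  forall x, N x ->
  exists (U : set 'rV[R]_m) (V : set 'rV[R]_d)
         (phi : 'rV[R]_m -> 'rV[R]_d) (psi : 'rV[R]_d -> 'rV[R]_m),
    [/\ open U, U 0, open V, Ck k U phi & phi 0 = x] /\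
    [/\ phi @` U = N `&` V,
        (forall u, U u -> psi (phi u) = u),
        {within N `&` V, continuous psi}
      & injective ('d phi 0)].

Definition zero_set (d : nat) (Omega : set 'rV[R]_d) (f : 'rV[R]_d -> R) :=
  [set x | Omega x /\ f x = 0].

Definition NHC (d : nat) (Omega : set 'rV[R]_d) (f : 'rV[R]_d -> R)
  (x0 : 'rV[R]_d) : Prop :=
  exists (d0 k : nat) (N : set 'rV[R]_d),
    [/\ (d0 <= d)%N, (1 <= k)%N, submanifold k d0 N, N x0 &
        N `<=` zero_set Omega f] /\
    \rank (hessian f x0) = (d - d0)%N.

Definition supp_in (d : nat) (Omega : set 'rV[R]_d) (g : 'rV[R]_d -> R) :=
  Omega `&` closure [set y | Omega y /\ g y != 0].

Definition locally_finite_supp (d : nat) (Omega : set 'rV[R]_d) (I : set nat)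
  (fam : nat -> 'rV[R]_d -> R) : Prop :=
  forall x, Omega x -> exists W : set 'rV[R]_d,
    [/\ open W, W x &
        finite_set [set i | I i /\ (W `&` Omega `&` supp_in Omega (fam i)) !=set0]].

Definition SOS_decomp (d q : nat) (Omega : set 'rV[R]_d) (f : 'rV[R]_d -> R)
  (I : set nat) (fam : nat -> 'rV[R]_d -> R) : Prop :=
  [/\ countable I,
      (forall i, I i -> Ck q Omega (fam i)),
      locally_finite_supp Omega I fam &
      forall x, Omega x ->
        ((f x)%:E = \esum_(i in I) ((fam i x) ^+ 2)%:E)%E].

End Defs.

(* Main.v *)
Require Import Defs.
From HB Require Import structures.
From mathcomp Require Import all_boot all_order all_algebra.
From mathcomp Require Import all_classical all_reals all_analysis.
From mathcomp Require Import ring lra zify.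
From mathcomp Require finmap.
Set Implicit Arguments. Unset Strict Implicit. Unset Printing Implicit Defensive.
Import Order.TTheory GRing.Theory Num.Theory.
Import numFieldNormedType.Exports.
Local Open Scope classical_set_scope.
Local Open Scope ring_scope.

(** Near a zero [x0], pick a coordinate [j] with [d_jj f (x0) > 0]. The equation
    [d_j f = 0] defines [x_j = g(x)], with [g] independent of [x_j], and Taylor's
    formula with integral remainder gives [f = ((x_j - g) sqrt h)^2 + F], where
    [h] is of class [C^(p-2)] and positive, and [F = f o (x_j := g)] is again a
    non-negative [C^p] function, of the remaining coordinates, whose Hessian is the
    Schur complement. Repeating this until the Hessian vanishes leaves an [F] that
    depends on exactly [dim N] coordinates. The tangent space of [N] is the kernel
    of the Hessian and projects isomorphically onto these coordinates, so the
    projection of [N] covers a neighbourhood of [x0], and [F = 0] there.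

    The local decompositions are glued with functions [b] of class [C^(p-2)]: if
    [u] collects all the products [b a] and [D = \sum b^2 > 0], then
    [f = \sum (u / sqrt D)^2]. Under the strict condition the zeros are isolated,
    the cut-offs around them can be given disjoint supports, so the [d] local
    functions are merged into [d] global ones, and one more function [c sqrt f]
    takes care of the complement of the zero set. *)

(** * Calculus of C^k functions *)

(** The elimination can be iterated because the loss of two derivatives never accumulates. Along the
    graph of [g] the derivative [d_j f] vanishes, so the gradient of [F] contains no derivative of
    [g]: it is the composite of [d_l f] with the graph map, both of class $C^{p-1}$, and [F] is of
    class $C^p$ again. Only the weight [h], an integral of [d_jj f], drops to $C^{p-2}$, and it
    stays inside the square already split off.

    Vectors are rows, so the kernel of the Hessian [H] means the solutions of [v H = 0]. That the
    tangent space lies in it follows by differentiating [d_b f (phi u) = 0]; the rank condition then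
    closes the dimension count.

    Each local identity enters multiplied by $b^2$, hence the division by the root of $\sum b^2$.
    The cut-offs are powers of positive parts, just regular enough for the target class. Balls are
    those of the sup norm, that is boxes, so coordinates can be changed one at a time without
    leaving them. *)

Section CkCalculus.
Variable R : realType.

Lemma ball_rVP (n : nat) (x y : 'rV[R]_n) (e : R) :
  ball x e y <-> 0 < e /\ forall k, `|x 0 k - y 0 k| < e.
Proof.
split=> [[e0 H]|[e0 H]]; split => //.
  by move=> k; exact: H.
by move=> i k; rewrite ord1; exact: H.
Qed.

Lemma continuous_ballP (n : nat) (f : 'rV[R]_n -> R) (x : 'rV[R]_n) :
  {for x, continuous f} <->
  forall e, 0 < e -> exists2 r, 0 < r & forall y, ball x r y -> `|f y - f x| < e.
Proof.
split=> [cf e e0|H].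
  have /cvgrPdist_lt /(_ _ e0) /nbhs_ballP[r /= r0 Hr] := cf.
  by exists r => // y /Hr; rewrite distrC.
move=> A /nbhs_ballP[e /= e0 eA]; have [r r0 Hr] := H e e0.
by apply/nbhs_ballP; exists r => // y /Hr yr; apply: eA; rewrite /ball/= distrC.
Qed.

Lemma continuous_rVP (n m : nat) (u : 'rV[R]_n -> 'rV[R]_m) (x : 'rV[R]_n) :
  {for x, continuous u} <-> forall k, {for x, continuous (fun y => u y 0 k)}.
Proof.
split=> [cu k|cu].
  exact: (continuous_comp (g := fun M : 'rV[R]_m => M 0 k)) cu (@coord_continuous _ _ _ _ _ _).
move=> A /nbhs_ballP[e /= e0 eA].
have : forall k, \forall y \near x, `|u x 0 k - u y 0 k| < e.
  by move=> k; have /cvgrPdist_lt := cu k; exact.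
move=> /filter_forall; apply: filterS => y Hy.
by apply: eA; apply/ball_rVP.
Qed.

Lemma is_deriveP (V : normedModType R) (f : V -> R) (x v : V) (l : R) :
  is_derive x v f l <->
  forall e, 0 < e -> exists2 r, 0 < r &
    forall h, h != 0 -> `|h| < r -> `|(f (h *: v + x) - f x) / h - l| < e.
Proof.
split=> [[df dl] e e0|H].
  have : (fun h : R => h^-1 *: ((f \o shift x) (h *: v) - f x)) @ 0^' --> l.
    by rewrite -dl; exact: df.
  move=> /cvgrPdist_lt /(_ _ e0); rewrite near_withinE => /nbhs_ballP[r /= r0 Hr].
  exists r => // h h0 hr; rewrite distrC mulrC.
  by apply: (Hr h) => //; rewrite /ball/= sub0r normrN.
have cl : (fun h : R => h^-1 *: ((f \o shift x) (h *: v) - f x)) @ 0^' --> l.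
  apply/cvgrPdist_lt => e e0; have [r r0 Hr] := H e e0.
  rewrite near_withinE; apply/nbhs_ballP; exists r => // h /=.
  rewrite /ball/= sub0r normrN => hr h0; rewrite distrC [_ *: _]mulrC.
  exact: Hr.
split; last exact: cvg_lim cl.
by apply/cvg_ex; exists l.
Qed.

Lemma Ck_continuous k n (W : normedModType R) (U : set 'rV[R]_n)
  (f : 'rV[R]_n -> W) x : Ck k U f -> U x -> {for x, continuous f}.
Proof. by case: k => [|k] [H _]; exact: H. Qed.

Lemma Ck_partial k n (W : normedModType R) (U : set 'rV[R]_n)
  (f : 'rV[R]_n -> W) j : Ck k.+1 U f -> Ck k U (partial j f).
Proof. by move=> [_ [_ H]]; exact: H. Qed.

Lemma Ck_is_derive k n (W : normedModType R) (U : set 'rV[R]_n)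
  (f : 'rV[R]_n -> W) x j : Ck k.+1 U f -> U x ->
  is_derive x (basis_vec R j) f (partial j f x).
Proof. by move=> [_ [H _]] Ux; apply: DeriveDef => //; exact: H. Qed.

Lemma Ck_subset k n (W : normedModType R) (U V : set 'rV[R]_n)
  (f : 'rV[R]_n -> W) : V `<=` U -> Ck k U f -> Ck k V f.
Proof.
move=> VU; elim: k f => [|k IH] f [cf]; first by split => // x /VU /cf.
move=> [df pf]; split; first by move=> x /VU /cf.
by split=> [x /VU /df //|j]; apply: IH; exact: pf.
Qed.

Lemma CkW k n (W : normedModType R) (U : set 'rV[R]_n)
  (f : 'rV[R]_n -> W) : Ck k.+1 U f -> Ck k U f.
Proof.
elim: k f => [|k IH] f; first by case.
by move=> [cf [df pf]]; split => //; split => // j; exact/IH/pf.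
Qed.

Lemma Ck_leq k l n (W : normedModType R) (U : set 'rV[R]_n)
  (f : 'rV[R]_n -> W) : (l <= k)%N -> Ck k U f -> Ck l U f.
Proof.
move=> /subnK <-; elim: (k - l)%N => [|i IH]; first by rewrite add0n.
by rewrite addSn => /CkW.
Qed.

Lemma Ck_local k n (W : normedModType R) (U : set 'rV[R]_n) (f : 'rV[R]_n -> W) :
  (forall x, U x -> exists2 V : set 'rV[R]_n, V x & Ck k V f) -> Ck k U f.
Proof.
elim: k f => [|k IH] f H.
  by split => // x /H[V Vx] [cf _]; exact: cf.
split; first by move=> x /H[V Vx] [cf _]; exact: cf.
split; first by move=> x /H[V Vx] [_ [df _]]; exact: df.
by move=> j; apply: IH => x /H[V Vx] [_ [_ pf]]; exists V => //; exact: pf.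
Qed.

Lemma Ck_eq k n (W : normedModType R) (U : set 'rV[R]_n) (f g : 'rV[R]_n -> W) :
  open U -> (forall x, U x -> f x = g x) -> Ck k U f -> Ck k U g.
Proof.
move=> oU.
have nfg (h1 h2 : 'rV[R]_n -> W) : (forall x, U x -> h1 x = h2 x) ->
    forall x, U x -> {near x, h1 =1 h2}.
  by move=> h12 x Ux; apply: filterS (open_nbhs_nbhs (conj oU Ux)) => y /h12.
have cts (h1 h2 : 'rV[R]_n -> W) x : (forall x, U x -> h1 x = h2 x) -> U x ->
    {for x, continuous h1} -> {for x, continuous h2}.
  move=> h12 Ux ch1 A; rewrite -(h12 _ Ux) => /ch1 /= h1A.
  have h12x : nbhs x [set y | h1 y = h2 y] by exact: (nfg h1 h2).
  have : nbhs x (h1 @^-1` A) by exact: h1A.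
  by move: h12x; apply: filterS2 => y /= <-.
elim: k f g => [|k IH] f g fg.
  by move=> [cf _]; split => // x Ux; apply: cts (cf _ Ux).
move=> [cf [df pf]]; split; first by move=> x Ux; apply: cts (cf _ Ux).
split; first by move=> x Ux j; apply: near_eq_derivable (df _ Ux j); exact: nfg.
by move=> j; apply: IH (pf j) => x Ux; apply: near_eq_derive; exact: nfg.
Qed.

Lemma Ck_local_eq k n (W : normedModType R) (U : set 'rV[R]_n) (f : 'rV[R]_n -> W) :
  (forall x, U x -> exists (V : set 'rV[R]_n) (g : 'rV[R]_n -> W),
     [/\ open V, V x, Ck k V g & forall y, V y -> g y = f y]) -> Ck k U f.
Proof.
move=> H; apply: Ck_local => x /H[V [g [oV Vx cg gf]]].
by exists V => //; exact: Ck_eq cg.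
Qed.

(** Lets a derivative be supplied in closed form: [g] has to match the partial derivative on [U]
    only, and openness of [U] transfers its regularity to [partial j f]. *)
Lemma CkS_intro k n (U : set 'rV[R]_n) (f : 'rV[R]_n -> R) :
  open U -> (forall x, U x -> {for x, continuous f}) ->
  (forall j, exists2 g : 'rV[R]_n -> R, Ck k U g &
    forall x, U x -> is_derive x (basis_vec R j) f (g x)) ->
  Ck k.+1 U f.
Proof.
move=> oU cf H; split => //; split.
  by move=> x Ux j; have [g _ /(_ _ Ux) []] := H j.
move=> j; have [g cg dg] := H j.
apply: Ck_eq cg => // x Ux; by have [_ <-] := dg _ Ux.
Qed.

Lemma Ck_cst k n (U : set 'rV[R]_n) (c : R) : open U -> Ck k U (fun _ => c).
Proof.
move=> oU; elim: k c => [|k IH] c; first by split => // x _; exact: cst_continuous.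
apply: CkS_intro => //; first by move=> x _; exact: cst_continuous.
by move=> j; exists (fun _ => 0) => // x _; exact: is_derive_cst.
Qed.

Lemma Ck_add k n (U : set 'rV[R]_n) (f g : 'rV[R]_n -> R) : open U ->
  Ck k U f -> Ck k U g -> Ck k U (fun x => f x + g x).
Proof.
move=> oU; elim: k f g => [|k IH] f g cf cg.
  by split => // x Ux; apply: continuousD; [exact: (Ck_continuous cf Ux)|exact: (Ck_continuous cg Ux)].
apply: CkS_intro => //.
  by move=> x Ux; apply: continuousD; [exact: (Ck_continuous cf Ux)|exact: (Ck_continuous cg Ux)].
move=> j; exists (fun x => partial j f x + partial j g x).
  by apply: IH; exact: Ck_partial.
by move=> x Ux; apply: is_deriveD; [exact: (Ck_is_derive j cf Ux)|exact: (Ck_is_derive j cg Ux)].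
Qed.

Lemma Ck_mul k n (U : set 'rV[R]_n) (f g : 'rV[R]_n -> R) : open U ->
  Ck k U f -> Ck k U g -> Ck k U (fun x => f x * g x).
Proof.
move=> oU; elim: k f g => [|k IH] f g cf cg.
  by split => // x Ux; apply: continuousM; [exact: (Ck_continuous cf Ux)|exact: (Ck_continuous cg Ux)].
apply: CkS_intro => //.
  by move=> x Ux; apply: continuousM; [exact: (Ck_continuous cf Ux)|exact: (Ck_continuous cg Ux)].
move=> j; exists (fun x => f x * partial j g x + g x * partial j f x).
  by apply: Ck_add => //; apply: IH; try exact: CkW; exact: Ck_partial.
by move=> x Ux; apply: is_deriveM; [exact: (Ck_is_derive j cf Ux)|exact: (Ck_is_derive j cg Ux)].
Qed.

Lemma Ck_opp k n (U : set 'rV[R]_n) (f : 'rV[R]_n -> R) : open U ->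
  Ck k U f -> Ck k U (fun x => - f x).
Proof.
move=> oU cf; apply: (Ck_eq (f := fun x => (-1) * f x)) => //.
  by move=> x _; rewrite mulN1r.
by apply: Ck_mul => //; exact: Ck_cst.
Qed.

Lemma Ck_sub k n (U : set 'rV[R]_n) (f g : 'rV[R]_n -> R) : open U ->
  Ck k U f -> Ck k U g -> Ck k U (fun x => f x - g x).
Proof. by move=> oU cf cg; apply: Ck_add => //; exact: Ck_opp. Qed.

Lemma Ck_sum k n (U : set 'rV[R]_n) (I : Type) (s : seq I) (P : pred I)
  (f : I -> 'rV[R]_n -> R) : open U ->
  (forall i, P i -> Ck k U (f i)) -> Ck k U (fun x => \sum_(i <- s | P i) f i x).
Proof.
move=> oU cf; elim: s => [|i s IH].
  by apply: Ck_eq (Ck_cst k 0 oU) => // x _; rewrite big_nil.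
have [Pi|nPi] := boolP (P i); last first.
  by apply: Ck_eq IH => // x _; rewrite big_cons (negbTE nPi).
by apply: Ck_eq (Ck_add oU (cf _ Pi) IH) => // x _; rewrite big_cons Pi.
Qed.

Lemma Ck_prod k n (U : set 'rV[R]_n) (I : Type) (s : seq I) (P : pred I)
  (f : I -> 'rV[R]_n -> R) : open U ->
  (forall i, P i -> Ck k U (f i)) -> Ck k U (fun x => \prod_(i <- s | P i) f i x).
Proof.
move=> oU cf; elim: s => [|i s IH].
  by apply: Ck_eq (Ck_cst k 1 oU) => // x _; rewrite big_nil.
have [Pi|nPi] := boolP (P i); last first.
  by apply: Ck_eq IH => // x _; rewrite big_cons (negbTE nPi).
by apply: Ck_eq (Ck_mul oU (cf _ Pi) IH) => // x _; rewrite big_cons Pi.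
Qed.

Lemma is_derive_coord n (x : 'rV[R]_n) (i j : 'I_n) :
  is_derive x (basis_vec R j) (fun y : 'rV[R]_n => y 0 i) (i == j)%:R.
Proof.
apply/is_deriveP => e e0; exists 1 => // h h0 _.
by rewrite !mxE eqxx /= addrK mulrAC divff // mul1r subrr normr0.
Qed.

Lemma Ck_coord k n (U : set 'rV[R]_n) (i : 'I_n) : open U -> Ck k U (fun x => x 0 i).
Proof.
move=> oU; case: k => [|k].
  by split => // x _; exact: coord_continuous.
apply: CkS_intro => //; first by move=> x _; exact: coord_continuous.
move=> j; exists (fun _ => (i == j)%:R); first exact: Ck_cst.
by move=> x _; exact: is_derive_coord.
Qed.

Lemma Ck_inv k n (U : set 'rV[R]_n) (f : 'rV[R]_n -> R) : open U ->
  (forall x, U x -> f x != 0) -> Ck k U f -> Ck k U (fun x => (f x)^-1).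
Proof.
move=> oU f0; elim: k => [|k IH] cf.
  by split => // x Ux; apply: continuousV; [exact: f0|exact: (Ck_continuous cf Ux)].
apply: CkS_intro => //.
  by move=> x Ux; apply: continuousV; [exact: f0|exact: (Ck_continuous cf Ux)].
have cfi := IH (CkW cf).
move=> j; exists (fun x => - ((f x)^-1 * (f x)^-1 * partial j f x)).
  apply: Ck_opp => //; apply: Ck_mul => //; first exact: Ck_mul.
  exact: Ck_partial.
move=> x Ux; have [d1 d2] := Ck_is_derive j cf Ux.
split; first by apply: derivableV => //; exact: f0.
by rewrite deriveV ?f0 // d2 -mulNr expr2 invfM.
Qed.

(** Restricting to the line [h *: v + x] turns the directional derivative of [f] into an ordinary
    one, to which the one-variable chain rule applies. *)
Lemma is_derive_comp1 n (f : 'rV[R]_n -> R) (phi : R -> R) x v df dphi :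
  is_derive x v f df -> is_derive (f x) 1 phi dphi ->
  is_derive x v (fun y => phi (f y)) (dphi * df).
Proof.
move=> [d1 d2] [d3 d4].
pose g (h : R) := f (h *: v + x).
have g0 : g 0 = f x by rewrite /g scale0r add0r.
have dg : derivable g 0 1 by exact: (derivable1P f x v).1 d1.
have DE (h : 'rV[R]_n -> R) : 'D_1 (fun t : R => h (t *: v + x)) 0 = 'D_v h x.
  rewrite /derive; set u := (X in lim (X @ _) = _); set w := (X in _ = lim (X @ _)).
  suff -> : u = w by [].
  by apply/funext => t; rewrite /u /w /= scale0r add0r addr0 [_ *: 1]mulr1.
have dp : derivable phi (g 0) 1 by rewrite g0.
have dc : derivable (phi \o g) 0 1.
  by apply/derivable1_diffP; apply: differentiable_comp; apply/derivable1_diffP.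
split; first exact: (derivable1P (fun y => phi (f y)) x v).2 dc.
rewrite -(DE (phi \o f)) -[LHS]/('D_1 (phi \o g) 0).
by rewrite -derive1E (derive1_comp dg dp) !derive1E (DE f) g0 d4 d2.
Qed.

Lemma Ck_sqrt k n (U : set 'rV[R]_n) (f : 'rV[R]_n -> R) : open U ->
  (forall x, U x -> 0 < f x) -> Ck k U f -> Ck k U (fun x => Num.sqrt (f x)).
Proof.
move=> oU f0; elim: k => [|k IH] cf.
  split => // x Ux; apply: continuous_comp; first exact: (Ck_continuous cf Ux).
  exact: sqrt_continuous.
apply: CkS_intro => //.
  move=> x Ux; apply: continuous_comp; first exact: (Ck_continuous cf Ux).
  exact: sqrt_continuous.
have cs := IH (CkW cf).
move=> j; exists (fun x => (2 * Num.sqrt (f x))^-1 * partial j f x).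
  apply: Ck_mul => //; last exact: Ck_partial.
  apply: Ck_inv => //.
    by move=> x Ux; rewrite mulf_neq0 // ?pnatr_eq0// gt_eqF // sqrtr_gt0 f0.
  by apply: Ck_mul => //; exact: Ck_cst.
move=> x Ux; apply: is_derive_comp1; first exact: (Ck_is_derive j cf Ux).
exact/is_derive1_sqrt/f0.
Qed.

Lemma is_derive_pospow k (t : R) :
  is_derive t 1 (fun s : R => (Num.max 0 s) ^+ k.+2) (k.+2%:R * (Num.max 0 t) ^+ k.+1).
Proof.
have [t0|t0|t0] := ltgtP 0 t.
- apply: (@near_eq_is_derive _ _ _ (fun s : R => s ^+ k.+2)).
    have : \forall s \near t, 0 < s by apply: open_nbhs_nbhs; split => //; exact: open_gt.
    by apply: filterS => s s0; rewrite max_r // ltW.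
  split; first exact: exprn_derivable.
  by rewrite exp_derive /= [LHS]mulr1.
- apply: (@near_eq_is_derive _ _ _ (fun s : R => 0)).
    have : \forall s \near t, s < 0 by apply: open_nbhs_nbhs; split => //; exact: open_lt.
    by apply: filterS => s s0; rewrite max_l ?ltW // expr0n.
  by rewrite expr0n mulr0; exact: is_derive_cst.
- rewrite -t0 expr0n mulr0; apply/is_deriveP => e e0.
  exists (Num.min 1 e); first by rewrite lt_min ltr01.
  move=> h h0; rewrite lt_min => /andP[h1 he].
  rewrite maxxx expr0n !subr0 [h *: 1]mulr1 addr0.
  have [hp|hp|hp] := ltgtP 0 h; last by rewrite hp eqxx in h0.
    rewrite exprS mulrAC divff ?gt_eqF // mul1r exprS normrM.
    rewrite (le_lt_trans _ he) // ler_piMr // normrX exprn_ile1 //; exact: ltW.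
  by rewrite expr0n mul0r normr0.
Qed.

(** Source of all cut-off functions: differentiation lowers the exponent by one, so each unit of
    exponent beyond the first buys one derivative. *)
Lemma Ck_pospow k n (U : set 'rV[R]_n) (f : 'rV[R]_n -> R) : open U ->
  Ck k U f -> Ck k U (fun x => (Num.max 0 (f x)) ^+ k.+1).
Proof.
have cmax l : continuous (fun s : R => (Num.max 0 s) ^+ l).
  move=> s; apply: (continuous_comp (f := fun s : R => Num.max 0 s) (g := fun s : R => s ^+ l)).
    by apply: (continuous_max (f := fun=> 0) (g := id)); [exact: cst_continuous|exact: cvg_id].
  exact: exprn_continuous.
move=> oU; elim: k => [|k IH] cf.
  split => // x Ux; apply: (continuous_comp (g := fun s : R => (Num.max 0 s) ^+ 1)).
    exact: (Ck_continuous cf Ux).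
  exact: cmax.
apply: CkS_intro => //.
  move=> x Ux; apply: (continuous_comp (g := fun s : R => (Num.max 0 s) ^+ k.+2)).
    exact: (Ck_continuous cf Ux).
  exact: cmax.
have cs := IH (CkW cf).
move=> j; exists (fun x => (k.+2%:R * Num.max 0 (f x) ^+ k.+1) * partial j f x).
  apply: Ck_mul => //; last exact: Ck_partial.
  by apply: Ck_mul => //; exact: Ck_cst.
move=> x Ux; apply: (is_derive_comp1 (phi := fun s : R => Num.max 0 s ^+ k.+2)).
  exact: (Ck_is_derive j cf Ux).
exact: is_derive_pospow.
Qed.

End CkCalculus.

(** * Mean value theorem and chain rule *)

Section ChainRule.
Variable R : realType.

Lemma rV_norm_coord (n : nat) (x : 'rV[R]_n) k : `|x 0 k| <= `|x|.
Proof.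
rewrite [leRHS]/Num.Def.normr/= mx_normrE.
exact: (le_bigmax _ (fun ij : 'I_1 * 'I_n => `|x ij.1 ij.2|) (0, k)).
Qed.

Lemma rV_norm_le (n : nat) (x : 'rV[R]_n) c : 0 <= c ->
  (forall k, `|x 0 k| <= c) -> `|x| <= c.
Proof.
move=> c0 H; rewrite [leLHS]/Num.Def.normr/= mx_normrE.
by apply/bigmax_leP; split => // -[i k] _ /=; rewrite ord1.
Qed.

Definition upd n (x : 'rV[R]_n) (j : 'I_n) (t : R) : 'rV[R]_n :=
  \row_k (if k == j then t else x 0 k).

Lemma updE n (x : 'rV[R]_n) j t k : upd x j t 0 k = if k == j then t else x 0 k.
Proof. by rewrite mxE. Qed.

Lemma upd_id n (x : 'rV[R]_n) j : upd x j (x 0 j) = x.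
Proof. by apply/rowP => k; rewrite updE; case: eqP => // ->. Qed.

Lemma upd_upd n (x : 'rV[R]_n) j s t : upd (upd x j s) j t = upd x j t.
Proof. by apply/rowP => k; rewrite !updE; case: eqP. Qed.

Lemma upd_addE n (x : 'rV[R]_n) j h : h *: basis_vec R j + x = upd x j (x 0 j + h).
Proof.
apply/rowP => k; rewrite updE !mxE eqxx /=; case: eqP => [->|_].
  by rewrite mulr1 addrC.
by rewrite mulr0 add0r.
Qed.

Lemma is_derive_upd n (f : 'rV[R]_n -> R) x j t l :
  is_derive (upd x j t) (basis_vec R j) f l <->
  is_derive t 1 (fun s => f (upd x j s)) l.
Proof.
split=> /is_deriveP H; apply/is_deriveP => e /H[r r0 Hr]; exists r => // h h0 hr.
  have := Hr h h0 hr; rewrite upd_addE upd_upd updE eqxx.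
  by rewrite [h *: 1 + t]addrC [h *: 1]mulr1.
have := Hr h h0 hr; rewrite upd_addE upd_upd updE eqxx.
by rewrite [h *: 1 + t]addrC [h *: 1]mulr1.
Qed.

(** The closed interval with its endpoints in either order, so that increments of both signs are
    treated at once. *)
Definition between (a b t : R) := Num.min a b <= t <= Num.max a b.

Lemma between_norm (c r a b t : R) :
  `|c - a| < r -> `|c - b| < r -> between a b t -> `|c - t| < r.
Proof.
rewrite /between minEle maxEle => ca cb.
case: (leP a b) => ab /andP[t1 t2]; move: ca cb; rewrite !ltr_norml => /andP[? ?] /andP[? ?].
  by apply/andP; split; lra.
by apply/andP; split; lra.
Qed.

Lemma ball_between n (x a b y : 'rV[R]_n) r : ball x r a -> ball x r b ->
  (forall k, between (a 0 k) (b 0 k) (y 0 k)) -> ball x r y.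
Proof.
move=> /ball_rVP[r0 xa] /ball_rVP[_ xb] H; apply/ball_rVP; split => // k.
exact: between_norm (xa k) (xb k) (H k).
Qed.

Lemma mvt_coord n (f : 'rV[R]_n -> R) x j a b :
  (forall t, between a b t -> derivable f (upd x j t) (basis_vec R j)) ->
  exists2 c, between a b c &
    f (upd x j b) - f (upd x j a) = (b - a) * partial j f (upd x j c).
Proof.
wlog ab : a b / a <= b.
  move=> W H; case: (leP a b) => [|/ltW] ab; first exact: W.
  have [|c Hc E] := W b a ab.
    by move=> t Ht; apply: H; rewrite /between minC maxC.
  exists c; first by rewrite /between minC maxC.
  by rewrite -opprB E -mulNr opprB.
rewrite /between min_l // max_r // => H.
have D t : t \in `[a, b]%R ->
    is_derive t 1 (fun s => f (upd x j s)) (partial j f (upd x j t)).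
  rewrite in_itv/= => Ht; apply/is_derive_upd.
  by apply: DeriveDef; [exact: H|].
have [c ci E] := @MVT_segment R (fun s => f (upd x j s))
   (fun s => partial j f (upd x j s)) a b ab
   (fun t Ht => D t (subset_itv_oo_cc Ht))
   (derivable_within_continuous (fun t Ht => @ex_derive _ _ _ _ _ _ _ (D t Ht))).
exists c; first by move: ci; rewrite in_itv.
by rewrite E mulrC.
Qed.

(** Coordinates are switched from [a] to [b] one at a time through the hybrids [hyb i], each step
    being a one-variable mean value theorem. Hence one intermediate point per coordinate, all in the
    box spanned by [a] and [b]. *)
Lemma mvt_rV n (f : 'rV[R]_n -> R) (a b : 'rV[R]_n) :
  (forall y : 'rV[R]_n, (forall k, between (a 0 k) (b 0 k) (y 0 k)) ->
     forall j, derivable f y (basis_vec R j)) ->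
  exists2 xi : 'I_n -> 'rV[R]_n,
    forall i k, between (a 0 k) (b 0 k) (xi i 0 k) &
    f b - f a = \sum_i (b 0 i - a 0 i) * partial i f (xi i).
Proof.
move=> H.
pose hyb (i : nat) : 'rV[R]_n := \row_k (if (k < i)%N then b 0 k else a 0 k).
have bab s t : between s t s /\ between s t t.
  by rewrite /between ge_min le_max ge_min le_max !lexx !orbT.
have hybS (i : 'I_n) : hyb i.+1 = upd (hyb i) i (b 0 i).
  apply/rowP => k; rewrite !mxE ltnS leq_eqVlt.
  by have [->|ki] := eqVneq k i; rewrite ?eqxx // val_eqE (negbTE ki).
have hybi (i : 'I_n) : hyb i = upd (hyb i) i (a 0 i).
  by apply/rowP => k; rewrite !mxE; case: eqP => // ->; rewrite ltnn.
have hb (i : 'I_n) t k : between (a 0 i) (b 0 i) t ->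
    between (a 0 k) (b 0 k) (upd (hyb i) i t 0 k).
  move=> Ht; rewrite !mxE; case: eqP => [->//|_].
  by case: ifP => _; [have [] := bab (a 0 k) (b 0 k)|have [] := bab (a 0 k) (b 0 k)].
have Hi (i : 'I_n) : exists y : 'rV[R]_n, (forall k, between (a 0 k) (b 0 k) (y 0 k)) /\
    f (hyb i.+1) - f (hyb i) = (b 0 i - a 0 i) * partial i f y.
  have [|c Hc E] := @mvt_coord n f (hyb i) i (a 0 i) (b 0 i).
    by move=> t Ht; apply: H => k; exact: hb.
  by exists (upd (hyb i) i c); split; [move=> k; exact: hb|rewrite hybS {2}hybi].
have [xi Hxi] := choice Hi.
exists xi; first by move=> i; have [] := Hxi i.
have <- : hyb n = b by apply/rowP => k; rewrite mxE ltn_ord.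
have <- : hyb 0%N = a by apply/rowP => k; rewrite mxE.
rewrite -(telescope_sumr (fun i => f (hyb i))) // big_mkord.
apply: eq_bigr => i _; have [_ ->] := Hxi i.
by congr ((_ - _) * _); rewrite mxE ?ltn_ord.
Qed.

Lemma open_ball_rV n (U : set 'rV[R]_n) x : open U -> U x ->
  exists2 r, 0 < r & forall y, ball x r y -> U y.
Proof. by move=> oU Ux; have /nbhs_ballP[r r0 H] := open_nbhs_nbhs (conj oU Ux); exists r. Qed.

Lemma ball_le_rV n (x y : 'rV[R]_n) r s : r <= s -> ball x r y -> ball x s y.
Proof. move=> rs xy; exact: (le_ball rs xy). Qed.

Lemma is_derive_cvg0 n (f : 'rV[R]_n -> R) x v l : is_derive x v f l ->
  f (h *: v + x) @[h --> (0 : R)^'] --> f x.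
Proof.
move=> [d1 _]; have /derivable1P/derivable1_diffP/differentiable_continuous := d1.
by move=> /continuous_withinNx; rewrite scale0r add0r.
Qed.

Lemma cvg_sum_ord (T : Type) (F : set_system T) {FF : Filter F} (m : nat)
  (g : 'I_m -> T -> R) (l : 'I_m -> R) :
  (forall i, g i @ F --> l i) -> (fun t => \sum_i g i t) @ F --> \sum_i l i.
Proof.
move=> H; elim: (index_enum _) => [|i s IH].
  rewrite big_nil (_ : (fun _ => _) = cst 0); first exact: cvg_cst.
  by apply/funext => t; rewrite big_nil.
rewrite big_cons (_ : (fun _ => _) = (fun t => g i t + \sum_(i <- s) g i t)).
  exact: cvgD.
by apply/funext => t; rewrite big_cons.
Qed.

(** By [mvt_rV] the increment of [f] is a sum of increments of [u] times partial derivatives at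
    points squeezed between [u x] and [u (h *: v + x)]. These points tend to [u x], and continuity
    of the partial derivatives gives the limit. *)
Lemma is_derive_chain n m (f : 'rV[R]_m -> R) (u : 'rV[R]_n -> 'rV[R]_m) x v
  (V : set 'rV[R]_m) (du : 'I_m -> R) :
  open V -> V (u x) ->
  (forall y, V y -> forall i, derivable f y (basis_vec R i)) ->
  (forall i, {for u x, continuous (partial i f)}) ->
  (forall i, is_derive x v (fun y => u y 0 i) (du i)) ->
  is_derive x v (fun y => f (u y)) (\sum_i du i * partial i f (u x)).
Proof.
move=> oV Vx df cf Du.
have [r r0 rV] := open_ball_rV oV Vx.
have nb s : 0 < s -> \forall h \near (0 : R)^', ball (u x) s (u (h *: v + x)).
  move=> s0.
  have : forall i, \forall h \near (0 : R)^', `|u x 0 i - u (h *: v + x) 0 i| < s.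
    by move=> i; have /is_derive_cvg0/cvgrPdist_lt := Du i; exact.
  by move=> /filter_forall; apply: filterS => h Hh; apply/ball_rVP.
have Hxi (h : R) : exists xi : 'I_m -> 'rV[R]_m, ball (u x) r (u (h *: v + x)) ->
   (forall i k, between (u x 0 k) (u (h *: v + x) 0 k) (xi i 0 k)) /\
   f (u (h *: v + x)) - f (u x) =
     \sum_i (u (h *: v + x) 0 i - u x 0 i) * partial i f (xi i).
  have [b|nb'] := pselect (ball (u x) r (u (h *: v + x))); last by exists (fun=> 0).
  have [|xi X1 X2] := @mvt_rV m f (u x) (u (h *: v + x)).
    move=> y Hy; apply/df/rV; apply: ball_between b Hy; exact: ballxx.
  by exists xi.
have [xi X] := choice Hxi.
have cl : (fun h : R => h^-1 *: (((fun y => f (u y)) \o shift x) (h *: v) - f (u x))) @ (0 : R)^'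
    --> \sum_i du i * partial i f (u x).
  have : (fun h : R => \sum_i (h^-1 *: (u (h *: v + x) 0 i - u x 0 i)) * partial i f (xi h i)) @ (0 : R)^'
    --> \sum_i du i * partial i f (u x).
    apply: cvg_sum_ord => i.
    apply: cvgM.
      by have [d1 <-] := Du i; exact: d1.
    apply/cvgrPdist_lt => e e0.
    have /continuous_ballP /(_ e e0)[s s0 Hs] := cf i.
    have Hms : 0 < Num.min r s by rewrite lt_min r0.
    have b1 y : ball (u x) (Num.min r s) y -> ball (u x) r y.
      by apply: ball_le_rV; rewrite ge_min lexx.
    apply: filterS (nb _ Hms) => h Hh; rewrite distrC; apply: Hs.
    have [X1 _] := X h (b1 _ Hh).
    apply: ball_between (X1 i); first exact: ballxx.
    by apply: ball_le_rV Hh; rewrite ge_min lexx orbT.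
  apply: cvg_trans; apply: near_eq_cvg.
  apply: filterS (nb _ r0) => h Hh /=.
  have [_ ->] := X h Hh.
  by rewrite scaler_sumr; apply: eq_bigr => i _; rewrite scalerAl.
split; last exact: cvg_lim cl.
by apply/cvg_ex; eexists; exact: cl.
Qed.

Lemma Ck_comp k n m (U : set 'rV[R]_n) (V : set 'rV[R]_m)
  (f : 'rV[R]_m -> R) (u : 'rV[R]_n -> 'rV[R]_m) :
  open U -> open V -> (forall x, U x -> V (u x)) ->
  Ck k V f -> (forall i, Ck k U (fun x => u x 0 i)) -> Ck k U (fun x => f (u x)).
Proof.
move=> oU oV UV; elim: k f => [|k IH] f cf cu.
  split => // x Ux; apply: continuous_comp.
    by apply/continuous_rVP => i; exact: Ck_continuous (cu i) Ux.
  exact: Ck_continuous cf (UV _ Ux).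
apply: CkS_intro => //.
  move=> x Ux; apply: continuous_comp.
    by apply/continuous_rVP => i; exact: Ck_continuous (cu i) Ux.
  exact: Ck_continuous cf (UV _ Ux).
move=> j; exists (fun x => \sum_i partial j (fun x => u x 0 i) x * partial i f (u x)).
  apply: Ck_sum => // i _; apply: Ck_mul => //.
    exact: Ck_partial.
  by apply: IH; [exact: Ck_partial|move=> i'; exact: CkW].
move=> x Ux; apply: is_derive_chain oV (UV _ Ux) _ _ _.
- by move=> y Vy i; have [] := Ck_is_derive i cf Vy.
- by move=> i; exact: Ck_continuous (Ck_partial i cf) (UV _ Ux).
- by move=> i; exact: Ck_is_derive (cu i) Ux.
Qed.

Lemma Ck_component k n m (U : set 'rV[R]_n) (phi : 'rV[R]_n -> 'rV[R]_m) i :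
  open U -> Ck k U phi -> Ck k U (fun x => phi x 0 i).
Proof.
move=> oU; elim: k phi => [|k IH] phi cphi.
  by split => // x Ux; have /continuous_rVP := Ck_continuous cphi Ux; exact.
have D x j : U x -> is_derive x (basis_vec R j) (fun y => phi y 0 i) (partial j phi x 0 i).
  move=> Ux; have [d1 d2] := Ck_is_derive j cphi Ux.
  have d1' := (derivable_mxP _ _ _).1 d1.
  split; first exact: d1'.
  by rewrite /partial derive_mx // mxE.
apply: CkS_intro => //.
  by move=> x Ux; have /continuous_rVP := Ck_continuous cphi Ux; exact.
move=> j; exists (fun x => partial j phi x 0 i); first exact/IH/Ck_partial.
by move=> x Ux; exact: D.
Qed.

(** Strict differentiability: the error is controlled for two moving points [a] and [b], as a Newton
    step from an arbitrary point of the ball requires. *)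
Lemma C1_strict n (U : set 'rV[R]_n) (f : 'rV[R]_n -> R) x e :
  open U -> U x -> Ck 1 U f -> 0 < e ->
  exists2 r, 0 < r & (forall y, ball x r y -> U y) /\
    forall a b, ball x r a -> ball x r b ->
    `|f b - f a - \sum_l (b 0 l - a 0 l) * partial l f x| <= e * `|b - a|.
Proof.
move=> oU Ux cf e0; have [r0 r00 rU] := open_ball_rV oU Ux.
(* The error is a sum of [n] terms; dividing by [n.+1] also covers [n = 0]. *)
pose e' := e / n.+1%:R.
have e'0 : 0 < e' by rewrite divr_gt0.
have : forall l, \forall y \near x, `|partial l f x - partial l f y| < e'.
  by move=> l; have /cvgrPdist_lt := Ck_continuous (Ck_partial l cf) Ux; exact.
move=> /filter_forall/nbhs_ballP[r1 /= r10 Hr1].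
exists (Num.min r0 r1); first by rewrite lt_min r00.
have b0 y : ball x (Num.min r0 r1) y -> ball x r0 y.
  by apply: ball_le_rV; rewrite ge_min lexx.
have b1 y : ball x (Num.min r0 r1) y -> ball x r1 y.
  by apply: ball_le_rV; rewrite ge_min lexx orbT.
split; first by move=> y /b0/rU.
move=> a b xa xb.
have [|xi X1 ->] := @mvt_rV n f a b.
  move=> y Hy j; have Uy : U y by apply/rU/b0; exact: ball_between Hy.
  by have [] := Ck_is_derive j cf Uy.
rewrite -sumrB.
apply: (@le_trans _ _ (\sum_(i < n) e' * `|b - a|)); last first.
  rewrite sumr_const card_ord -mulr_natl mulrA ler_wpM2r // /e' mulrCA ler_piMr ?(ltW e0) //.
  by rewrite ler_pdivrMr // mul1r ler_nat.
apply: le_trans (ler_norm_sum _ _ _) _; apply: ler_sum => l _.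
rewrite -mulrBr normrM mulrC ler_pM //; last first.
  by have := rV_norm_coord (b - a) l; rewrite !mxE.
by rewrite distrC ltW //; apply: (Hr1 (xi l)); apply/b1; exact: ball_between (X1 l).
Qed.

(** Bridge from the differential in [submanifold] to partial derivatives: its injectivity becomes
    that of a matrix acting on row vectors. *)
Lemma C1_diff n m (U : set 'rV[R]_n) (phi : 'rV[R]_n -> 'rV[R]_m) x :
  open U -> U x -> Ck 1 U phi ->
  ('d phi x : 'rV[R]_n -> 'rV[R]_m) =
  mulmxr (\matrix_(l, i) partial l (fun y => phi y 0 i) x).
Proof.
move=> oU Ux cphi; set J := \matrix_(l, i) _.
have cphii i := Ck_component i oU cphi.
apply: diff_unique.
  move=> y; apply/continuous_rVP => i /=.
  have -> : (fun z : 'rV[R]_n => (z *m J) 0 i) = (fun z => \sum_l z 0 l * J l i).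
    by apply/funext => z; rewrite mxE.
  apply: (@Ck_continuous R 0 n _ setT); last by [].
  apply: Ck_sum; first exact: openT.
  by move=> l _; apply: Ck_mul; [exact: openT|exact/Ck_coord/openT|exact/Ck_cst/openT].
apply/eqaddoP => e e0.
have : forall i, \forall h \near (0 : 'rV[R]_n),
   `|phi (h + x) 0 i - phi x 0 i - \sum_l h 0 l * J l i| <= e * `|h|.
  move=> i; have [r r0 [_ Hr]] := C1_strict oU Ux (cphii i) e0.
  apply/nbhs_ballP; exists r => // h /ball_rVP[_ Hh] /=.
  have -> : \sum_l h 0 l * J l i =
     \sum_l ((h + x) 0 l - x 0 l) * partial l (fun y => phi y 0 i) x.
    by apply: eq_bigr => l _; rewrite !mxE addrK.
  have -> : `|h| = `|(h + x) - x| by rewrite addrK.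
  apply: Hr; first exact: ballxx.
  apply/ball_rVP; split => // k; have := Hh k.
  by rewrite !mxE sub0r opprD addrCA subrr addr0.
move=> /filter_forall; apply: filterS => h Hh.
apply: rV_norm_le; first by rewrite mulr_ge0 // ltW.
move=> i; apply: le_trans (Hh i).
by rewrite !mxE opprD addrA.
Qed.

End ChainRule.

(** * Integrals depending on a parameter *)

Section IntegralWithParameter.
Variable R : realType.

Definition int01 (k : R -> R) : R :=
  Rintegral (@lebesgue_measure R) `[0, 1]%classic k.

(** Two-sided continuity, at the endpoints too: the integrands come from functions that are
    continuous at every point of a larger set. *)
Definition cont01 (k : R -> R) := forall t, 0 <= t <= 1 -> {for t, continuous k}.

Lemma cont01_within k : cont01 k -> {within `[0, 1]%classic, continuous k}.
Proof.
move=> ck; apply: continuous_in_subspaceT => t; rewrite inE/= in_itv/=.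
exact: ck.
Qed.

Lemma cont01_integrable k : cont01 k ->
  (@lebesgue_measure R).-integrable `[0, 1]%classic (EFin \o k).
Proof.
move=> /cont01_within ck; apply: continuous_compact_integrable => //.
exact: segment_compact.
Qed.

Lemma int01B k1 k2 : cont01 k1 -> cont01 k2 ->
  int01 (fun t => k1 t - k2 t) = int01 k1 - int01 k2.
Proof. by move=> c1 c2; apply: RintegralB => //; exact: cont01_integrable. Qed.

Lemma int01Z c k : cont01 k -> int01 (fun t => c * k t) = c * int01 k.
Proof. by move=> c1; apply: RintegralZl => //; exact: cont01_integrable. Qed.

Lemma int01_le k1 k2 : cont01 k1 -> cont01 k2 ->
  (forall t, 0 <= t <= 1 -> k1 t <= k2 t) -> int01 k1 <= int01 k2.
Proof.
move=> c1 c2 H; apply: le_Rintegral; [by []|exact: cont01_integrable|exact: cont01_integrable|].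
by move=> t /=; rewrite in_itv/=; exact: H.
Qed.

Lemma eq_int01 k1 k2 : (forall t, 0 <= t <= 1 -> k1 t = k2 t) -> int01 k1 = int01 k2.
Proof.
by move=> H; apply: eq_Rintegral => t; rewrite inE/= in_itv/=; exact: H.
Qed.

Lemma cont01_cst c : cont01 (fun _ => c).
Proof. by move=> t _; exact: cst_continuous. Qed.

Lemma int01_cst c : int01 (fun _ => c) = c.
Proof.
rewrite /int01 Rintegral_cst //= lebesgue_measure_itv/= lte_fin ltr01/=.
by rewrite oppr0 addr0 mulr1.
Qed.

Lemma int01_norm_le k e : cont01 k ->
  (forall t, 0 <= t <= 1 -> `|k t| <= e) -> `|int01 k| <= e.
Proof.
move=> ck H; rewrite ler_norml; apply/andP; split.
  rewrite -[leLHS]int01_cst; apply: int01_le => //; first exact: cont01_cst.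
  by move=> t /H; rewrite ler_norml => /andP[].
rewrite -[leRHS]int01_cst; apply: int01_le => //; first exact: cont01_cst.
by move=> t /H; rewrite ler_norml => /andP[].
Qed.

Lemma int01_FTC (phi k : R -> R) : cont01 k ->
  (forall t : R, 0 <= t <= 1 -> is_derive t 1 phi (k t)) ->
  int01 k = phi 1 - phi 0.
Proof.
move=> ck D.
have cphi t : 0 <= t <= 1 -> {for t, continuous phi}.
  by move=> /D[/derivable1_diffP/differentiable_continuous].
rewrite /int01 /Rintegral (@continuous_FTC2 _ k phi) //=.
- exact: cont01_within.
- split.
  + by move=> t; rewrite in_itv/= => /andP[t0 t1]; have [] := D t; rewrite ?ltW.
  + by apply: cvg_at_right_filter; apply: cphi; rewrite lexx ler01.
  + by apply: cvg_at_left_filter; apply: cphi; rewrite lexx ler01.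
- move=> t; rewrite in_itv/= => /andP[t0 t1]; rewrite derive1E.
  by have [] := D t; rewrite ?ltW.
Qed.

(** The integration variable becomes coordinate 0, so that joint regularity in [(t, x)] is expressed
    by [Ck] on row vectors. *)
Definition rowcons n (t : R) (x : 'rV[R]_n) : 'rV[R]_n.+1 :=
  \row_k (if unlift ord0 k is Some l then x 0 l else t).

Lemma rowcons_0 n t (x : 'rV[R]_n) : rowcons t x 0 ord0 = t.
Proof. by rewrite mxE unlift_none. Qed.

Lemma rowcons_lift n t (x : 'rV[R]_n) l : rowcons t x 0 (lift ord0 l) = x 0 l.
Proof. by rewrite mxE liftK. Qed.

Lemma upd_rowcons n t (x : 'rV[R]_n) l s :
  upd (rowcons t x) (lift ord0 l) s = rowcons t (upd x l s).
Proof.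
apply/rowP => k; rewrite updE; case: (unliftP ord0 k) => [l'|] ->.
  by rewrite (inj_eq (@lift_inj _ _)) !rowcons_lift updE.
by rewrite !rowcons_0 (negbTE (neq_lift _ _)).
Qed.

Lemma ball_rowcons n t s (x y : 'rV[R]_n) r : `|t - s| < r -> ball x r y ->
  ball (rowcons t x) r (rowcons s y).
Proof.
move=> ts /ball_rVP[r0 xy]; apply/ball_rVP; split => // k.
by case: (unliftP ord0 k) => [l'|] ->; rewrite ?rowcons_lift ?rowcons_0.
Qed.

(** Compactness of [[0, 1]] makes the modulus of continuity in [x] uniform in [t]. *)
Lemma tube01 n (K : 'rV[R]_n.+1 -> R) x (e : R) :
  (forall t, 0 <= t <= 1 -> {for rowcons t x, continuous K}) -> 0 < e ->
  exists2 r, 0 < r & forall t y, 0 <= t <= 1 -> ball x r y ->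
    `|K (rowcons t y) - K (rowcons t x)| < e.
Proof.
move=> cK e0; have e20 : 0 < e / 2 by rewrite divr_gt0.
have /compact_near_coveringP := @segment_compact R 0 1.
pose P y t := `|K (rowcons t y) - K (rowcons t x)| < e.
move=> /(_ _ (nbhs x) P _) H.
have /nbhs_ballP[r r0 Hr] : nbhs x [set y | `[0, 1]%classic `<=` P y].
  apply: H.
  move=> t0; rewrite /= in_itv/= => /cK /continuous_ballP /(_ _ e20)[r r0 Hr].
  exists (ball t0 r, ball x r); first by split; apply/nbhs_ballP; exists r.
  move=> [t y] [/= t0t xy].
  have /Hr h1 := ball_rowcons t0t xy.
  have /Hr h2 := ball_rowcons t0t (ballxx x r0).
  by rewrite /P -(subrKA (K (rowcons t0 x))) (le_lt_trans (ler_normD _ _)) // (splitr e) ltrD // distrC.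
exists r => // t y t01 /Hr; apply.
by rewrite /= in_itv.
Qed.

Lemma cont01_rowcons n (K : 'rV[R]_n.+1 -> R) x :
  (forall t, 0 <= t <= 1 -> {for rowcons t x, continuous K}) ->
  cont01 (fun t => K (rowcons t x)).
Proof.
move=> cK t t01; apply/cvgrPdist_lt => e e0.
have /continuous_ballP /(_ e e0)[r r0 Hr] := cK t t01.
apply/nbhs_ballP; exists r => // s ts /=; rewrite distrC; apply: Hr.
by apply: ball_rowcons => //; exact: ballxx.
Qed.

Lemma cont01B k1 k2 : cont01 k1 -> cont01 k2 -> cont01 (fun t => k1 t - k2 t).
Proof. by move=> c1 c2 t t01; apply: continuousB; [exact: c1|exact: c2]. Qed.

Lemma cont01Z c k : cont01 k -> cont01 (fun t => c * k t).
Proof.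
by move=> c1 t t01; apply: continuousM; [exact: cst_continuous|exact: c1].
Qed.

Lemma continuous_int01 n (V : set 'rV[R]_n.+1) (U : set 'rV[R]_n)
  (K : 'rV[R]_n.+1 -> R) x :
  open U -> (forall x t, U x -> 0 <= t <= 1 -> V (rowcons t x)) ->
  (forall y, V y -> {for y, continuous K}) -> U x ->
  {for x, continuous (fun y => int01 (fun t => K (rowcons t y)))}.
Proof.
move=> oU UV cK Ux; apply/continuous_ballP => e e0.
have e20 : 0 < e / 2 by rewrite divr_gt0.
have [|r r0 Hr] := tube01 (K := K) (x := x) _ e20.
  by move=> t t01; apply/cK/UV.
have [r1 r10 HU] := open_ball_rV oU Ux.
exists (Num.min r r1); first by rewrite lt_min r0.
move=> y xy.
have xy0 : ball x r y by apply: ball_le_rV xy; rewrite ge_min lexx.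
have Uy : U y by apply: HU; apply: ball_le_rV xy; rewrite ge_min lexx orbT.
have c z : U z -> cont01 (fun t => K (rowcons t z)).
  by move=> Uz; apply: cont01_rowcons => t t01; apply/cK/UV.
rewrite -int01B; [|exact: c|exact: c].
apply: (@le_lt_trans _ _ (e / 2)); last by rewrite ltr_pdivrMr // ltr_pMr // ltr1n.
apply: int01_norm_le; first by apply: cont01B; exact: c.
by move=> t t01; apply/ltW/Hr.
Qed.

(** At each [t] the difference quotient of the integrand is, by the mean value theorem, a partial
    derivative at a point close to [x]; [tube01] brings it within [e / 2] of the value at [x] for
    all [t] simultaneously. *)
Lemma is_derive_int01 n (V : set 'rV[R]_n.+1) (U : set 'rV[R]_n)
  (K : 'rV[R]_n.+1 -> R) x l :
  open U -> (forall x t, U x -> 0 <= t <= 1 -> V (rowcons t x)) ->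
  Ck 1 V K -> U x ->
  is_derive x (basis_vec R l) (fun y => int01 (fun t => K (rowcons t y)))
    (int01 (fun t => partial (lift ord0 l) K (rowcons t x))).
Proof.
move=> oU UV cK Ux; apply/is_deriveP => e e0.
have e20 : 0 < e / 2 by rewrite divr_gt0.
have cdK y : V y -> {for y, continuous (partial (lift ord0 l) K)}.
  by move=> Vy; exact: Ck_continuous (Ck_partial _ cK) Vy.
have [|r r0 Hr] := tube01 (K := partial (lift ord0 l) K) (x := x) _ e20.
  by move=> t t01; apply/cdK/UV.
have [r1 r10 HU] := open_ball_rV oU Ux.
exists (Num.min r r1); first by rewrite lt_min r0.
move=> h h0; rewrite lt_min => /andP[hr hr1].
have c z : U z -> cont01 (fun t => K (rowcons t z)).
  move=> Uz; apply: cont01_rowcons => t t01.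
  exact: Ck_continuous cK (UV _ _ Uz t01).
have cd : cont01 (fun t => partial (lift ord0 l) K (rowcons t x)).
  by apply: cont01_rowcons => t t01; apply/cdK/UV.
have inb s t : `|h| < s -> between (x 0 l) (x 0 l + h) t -> ball x s (upd x l t).
  move=> hs Ht; apply/ball_rVP; split; first exact: le_lt_trans hs.
  move=> k; rewrite updE; case: eqP => [->|_]; last first.
    by rewrite subrr normr0 (le_lt_trans _ hs).
  apply: between_norm Ht; first by rewrite subrr normr0 (le_lt_trans _ hs).
  by rewrite opprD addrA subrr sub0r normrN.
have bt : between (x 0 l) (x 0 l + h) (x 0 l + h).
  by rewrite /between ge_min le_max lexx !orbT.
have Uh : U (h *: basis_vec R l + x) by rewrite upd_addE; apply/HU/inb.
rewrite -int01B; [|exact: c|exact: c].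
rewrite mulrC -int01Z; last by apply: cont01B; exact: c.
rewrite -int01B => //; last by apply: cont01Z; apply: cont01B; exact: c.
apply: (@le_lt_trans _ _ (e / 2)); last by rewrite ltr_pdivrMr // ltr_pMr // ltr1n.
apply: int01_norm_le.
  by apply: cont01B => //; apply: cont01Z; apply: cont01B; exact: c.
move=> t t01.
have [|s Hs] := @mvt_coord R n.+1 K (rowcons t x) (lift ord0 l) (x 0 l) (x 0 l + h).
  move=> s Hs; rewrite upd_rowcons.
  have Us : U (upd x l s) by apply/HU/inb.
  by have [] := Ck_is_derive (lift ord0 l) cK (UV _ _ Us t01).
rewrite !upd_rowcons upd_id -upd_addE => ->.
rewrite [x 0 l + h]addrC addrK mulKf //.
by apply/ltW/Hr => //; exact: inb.
Qed.

Lemma Ck_int01 k n (V : set 'rV[R]_n.+1) (U : set 'rV[R]_n) (K : 'rV[R]_n.+1 -> R) :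
  open U -> (forall x t, U x -> 0 <= t <= 1 -> V (rowcons t x)) ->
  Ck k V K -> Ck k U (fun x => int01 (fun t => K (rowcons t x))).
Proof.
move=> oU UV; elim: k K => [|k IH] K cK.
  split => // x Ux; apply: (continuous_int01 (V := V)) Ux => // y Vy.
  exact: Ck_continuous cK Vy.
apply: CkS_intro => //.
  move=> x Ux; apply: (continuous_int01 (V := V)) Ux => // y Vy.
  exact: Ck_continuous cK Vy.
move=> l; exists (fun x => int01 (fun t => partial (lift ord0 l) K (rowcons t x))).
  exact/IH/Ck_partial.
move=> x Ux; apply: is_derive_int01 UV _ Ux => //.
by apply: Ck_leq cK.
Qed.

End IntegralWithParameter.

(** * Implicit functions of one coordinate *)

Section ImplicitFunction.
Variable R : realType.

Lemma ball_open_rV n (x : 'rV[R]_n) (r : R) : open (ball x r).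
Proof. exact: ball_open. Qed.

Lemma ball_upd n (x y : 'rV[R]_n) j (r t : R) : ball x r y -> `|x 0 j - t| < r ->
  ball x r (upd y j t).
Proof.
move=> /ball_rVP[r0 xy] xt; apply/ball_rVP; split => // k.
by rewrite updE; case: eqP => // ->.
Qed.

Lemma ball_upd2 n (x y : 'rV[R]_n) j (r t : R) : ball x r y ->
  ball (upd x j t) r (upd y j t).
Proof.
move=> /ball_rVP[r0 xy]; apply/ball_rVP; split => // k.
by rewrite !updE; case: eqP => // _; rewrite subrr normr0.
Qed.

Section Implicit.
Variables (n k : nat) (m : 'rV[R]_n -> R) (x0 : 'rV[R]_n) (s : R) (j : 'I_n).
Hypothesis s0 : 0 < s.
Hypothesis cm : Ck k.+1 (ball x0 s) m.
Hypothesis m0 : m x0 = 0.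
Hypothesis dm : forall y, ball x0 s y -> 0 < partial j m y.

Lemma implicit_mono x t1 t2 : ball x0 s x -> `|x0 0 j - t1| < s -> `|x0 0 j - t2| < s ->
  t1 < t2 -> m (upd x j t1) < m (upd x j t2).
Proof.
move=> Bx b1 b2 t12.
have bt t : between t1 t2 t -> ball x0 s (upd x j t).
  by move=> Ht; apply: ball_upd => //; exact: between_norm Ht.
have [|c Hc E] := @mvt_coord R n m x j t1 t2.
  by move=> t Ht; have [] := Ck_is_derive j cm (bt _ Ht).
by rewrite -subr_gt0 E mulr_gt0 ?subr_gt0 //; apply/dm/bt.
Qed.

Lemma implicit_lt_inv x t1 t2 : ball x0 s x -> `|x0 0 j - t1| < s -> `|x0 0 j - t2| < s ->
  m (upd x j t1) < m (upd x j t2) -> t1 < t2.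
Proof.
move=> Bx b1 b2; case: (ltgtP t1 t2) => // [t21|->]; last by rewrite ltxx.
by have := implicit_mono Bx b2 b1 t21; case: ltgtP.
Qed.

Lemma implicit_uniq x t1 t2 : ball x0 s x -> `|x0 0 j - t1| < s -> `|x0 0 j - t2| < s ->
  m (upd x j t1) = 0 -> m (upd x j t2) = 0 -> t1 = t2.
Proof.
move=> Bx b1 b2 E1 E2; case: (ltgtP t1 t2) => // t12.
  by have := implicit_mono Bx b1 b2 t12; rewrite E1 E2 ltxx.
by have := implicit_mono Bx b2 b1 t12; rewrite E1 E2 ltxx.
Qed.

Lemma continuous_near_ball (f : 'rV[R]_n -> R) y (P : R -> Prop) :
  {for y, continuous f} -> (\forall z \near f y, P z) ->
  exists2 r, 0 < r & forall z, ball y r z -> P (f z).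
Proof. by move=> cf /cf /nbhs_ballP[r r0 H]; exists r. Qed.

Lemma implicit_sign x t : ball x0 s x -> `|x0 0 j - t| < s ->
  (0 < m (upd x j t) -> exists2 r, 0 < r & forall y, ball x r y -> 0 < m (upd y j t)) /\
  (m (upd x j t) < 0 -> exists2 r, 0 < r & forall y, ball x r y -> m (upd y j t) < 0).
Proof.
move=> Bx bt; have cu := Ck_continuous cm (ball_upd Bx bt); split => mt.
  have [|r r0 H] := continuous_near_ball (P := fun z => 0 < z) cu.
    by apply: open_nbhs_nbhs; split => //; exact: open_gt.
  by exists r => // y xy; apply/H/ball_upd2.
have [|r r0 H] := continuous_near_ball (P := fun z => z < 0) cu.
  by apply: open_nbhs_nbhs; split => //; exact: open_lt.
by exists r => // y xy; apply/H/ball_upd2.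
Qed.

(** [m] increases with coordinate [j], so around [x0] it is negative at height [x0 0 j - s / 2] and
    positive at [x0 0 j + s / 2]. Both signs persist for nearby [x], and the intermediate value
    theorem supplies the zero. *)
Lemma implicit_exists : exists (r : R) (g : 'rV[R]_n -> R), 0 < r <= s /\
  forall x, ball x0 r x -> `|x0 0 j - g x| < s /\ m (upd x j (g x)) = 0.
Proof.
pose s' := s / 2.
have s'0 : 0 < s' by rewrite divr_gt0.
have s's : s' < s by rewrite /s' ltr_pdivrMr // ltr_pMr // ltr1n.
have Bx0 : ball x0 s x0 by exact: ballxx.
have bp : `|x0 0 j - (x0 0 j + s')| < s.
  by rewrite opprD addrA subrr sub0r normrN gtr0_norm.
have bn : `|x0 0 j - (x0 0 j - s')| < s by rewrite subKr gtr0_norm.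
have bz : `|x0 0 j - x0 0 j| < s by rewrite subrr normr0.
have [r1 r10 H1] : exists2 r, 0 < r & forall y, ball x0 r y -> 0 < m (upd y j (x0 0 j + s')).
  apply: (implicit_sign Bx0 bp).1.
  rewrite -m0 -[in X in m X < _](upd_id x0 j); apply: implicit_mono => //.
  by rewrite ltrDl.
have [r2 r20 H2] : exists2 r, 0 < r & forall y, ball x0 r y -> m (upd y j (x0 0 j - s')) < 0.
  apply: (implicit_sign Bx0 bn).2.
  rewrite -m0 -[in X in _ < m X](upd_id x0 j); apply: implicit_mono => //.
  by rewrite gtrBl.
pose r := Num.min s (Num.min r1 r2).
have r0 : 0 < r by rewrite !lt_min s0 r10.
have ex x : exists t, ball x0 r x -> `|x0 0 j - t| < s /\ m (upd x j t) = 0.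
  have [Bx|] := pselect (ball x0 r x); last by exists 0.
  have Bxs : ball x0 s x by apply: ball_le_rV Bx; rewrite ge_min lexx.
  have /H1 h1 : ball x0 r1 x by apply: ball_le_rV Bx; rewrite !ge_min lexx orbT.
  have /H2 h2 : ball x0 r2 x by apply: ball_le_rV Bx; rewrite !ge_min lexx !orbT.
  have ss : x0 0 j - s' <= x0 0 j + s' by rewrite lerBlDr -addrA lerDl addr_ge0 // ltW.
  have bt t : t \in `[x0 0 j - s', x0 0 j + s']%R -> `|x0 0 j - t| < s.
    rewrite in_itv/= => /andP[t1 t2]; apply: le_lt_trans s's.
    by rewrite ler_norml; apply/andP; split; lra.
  have [||t Ht E] := @IVT R (fun t => m (upd x j t)) (x0 0 j - s') (x0 0 j + s') 0 ss.
  - apply: derivable_within_continuous => t /bt Ht.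
    by have /is_derive_upd[] := Ck_is_derive j cm (ball_upd Bxs Ht).
  - by rewrite ge_min le_max (ltW h2) (ltW h1) orbT.
  by exists t => _; split => //; exact: bt.
have [g Hg] := choice ex.
by exists r, g; split => //; rewrite r0 ge_min lexx.
Qed.

Variables (r : R) (g : 'rV[R]_n -> R).
Hypothesis rs : 0 < r <= s.
Hypothesis Hg : forall x, ball x0 r x -> `|x0 0 j - g x| < s /\ m (upd x j (g x)) = 0.

Let G x := upd x j (g x).

Let rBs x : ball x0 r x -> ball x0 s x.
Proof. by apply: ball_le_rV; case/andP: rs. Qed.

Lemma implicit_ball x : ball x0 r x -> ball x0 s (G x).
Proof. by move=> Bx; apply: ball_upd; [exact: rBs|have [] := Hg Bx]. Qed.

Lemma implicit_center : g x0 = x0 0 j.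
Proof.
have r0 : 0 < r by case/andP: rs.
have [b E] := Hg (ballxx x0 r0).
apply: implicit_uniq E _ => //; first by apply: rBs; exact: ballxx.
  by rewrite subrr normr0.
by rewrite upd_id.
Qed.

(** The signs of [m] at heights [g x + d] and [g x - d] persist for [y] near [x] and trap [g y]
    between the two. The choice of [d] keeps it below [e] and both heights within [s] of
    [x0 0 j]. *)
Lemma implicit_continuous x : ball x0 r x -> {for x, continuous g}.
Proof.
move=> Bx; apply/continuous_ballP => e e0.
have [b E] := Hg Bx.
pose d := Num.min (e / 2) ((s - `|x0 0 j - g x|) / 2).
have d0 : 0 < d by rewrite lt_min !divr_gt0 // subr_gt0.
have de : d < e.
  by rewrite gt_min ltr_pdivrMr // ltr_pMr // ltr1n.
have ds : d < s - `|x0 0 j - g x|.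
  rewrite gt_min; apply/orP; right; rewrite ltr_pdivrMr // ltr_pMr ?ltr1n //.
  by rewrite subr_gt0.
have bp : `|x0 0 j - (g x + d)| < s.
  rewrite opprD addrA (le_lt_trans (ler_normD _ _)) // normrN (gtr0_norm d0); lra.
have bn : `|x0 0 j - (g x - d)| < s.
  rewrite opprB addrCA addrC (le_lt_trans (ler_normD _ _)) // (gtr0_norm d0); lra.
have [r1 r10 H1] : exists2 r, 0 < r & forall y, ball x r y -> 0 < m (upd y j (g x + d)).
  apply: (implicit_sign (rBs Bx) bp).1.
  by rewrite -[X in X < _]E; apply: implicit_mono; rewrite ?ltrDl //; exact: rBs.
have [r2 r20 H2] : exists2 r, 0 < r & forall y, ball x r y -> m (upd y j (g x - d)) < 0.
  apply: (implicit_sign (rBs Bx) bn).2.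
  by rewrite -[X in _ < X]E; apply: implicit_mono; rewrite ?gtrBl //; exact: rBs.
have [r3 r30 H3] := open_ball_rV (@ball_open_rV n x0 r) Bx.
exists (Num.min r1 (Num.min r2 r3)); first by rewrite !lt_min r10 r20.
move=> y xy.
have /H1 h1 : ball x r1 y by apply: ball_le_rV xy; rewrite ge_min lexx.
have /H2 h2 : ball x r2 y by apply: ball_le_rV xy; rewrite !ge_min lexx orbT.
have /H3 By : ball x r3 y by apply: ball_le_rV xy; rewrite !ge_min lexx !orbT.
have [by_ Ey] := Hg By.
have u1 : g y < g x + d by apply: implicit_lt_inv (rBs By) by_ bp _; rewrite Ey.
have u2 : g x - d < g y by apply: implicit_lt_inv (rBs By) bn by_ _; rewrite Ey.
by rewrite ltr_norml; apply/andP; split; lra.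
Qed.

(** The value along [j] is 0 because uniqueness makes [g] insensitive to the coordinate it solves
    for. *)
Definition implicit_partial l x :=
  if l == j then 0 else - (partial l m (G x) / partial j m (G x)).

(** For [l] other than [j], [m] vanishes at [G x] and at [G (h *: basis_vec R l + x)], which differ
    in coordinates [l] and [j] only. So [mvt_rV] expresses the difference quotient of [g] exactly,
    as minus a ratio of partial derivatives at intermediate points, and these converge to [G x] by
    continuity of [g]. *)
Lemma is_derive_implicit x l : ball x0 r x ->
  is_derive x (basis_vec R l) g (implicit_partial l x).
Proof.
move=> Bx; rewrite /implicit_partial.
have [r1 r10 H1] := open_ball_rV (@ball_open_rV n x0 r) Bx.
have inb (h rho : R) : `|h| < rho -> ball x rho (h *: basis_vec R l + x).
  move=> hr; rewrite upd_addE; apply: ball_upd; first exact/ballxx/le_lt_trans/hr.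
  by rewrite opprD addrA subrr sub0r normrN.
case: (eqVneq l j) inb => [->|lj] inb.
  apply/is_deriveP => e e0; exists r1 => // h h0 hr.
  have By := H1 _ (inb _ _ hr).
  have [b1 E1] := Hg Bx; have [b2 E2] := Hg By.
  suff -> : g (h *: basis_vec R j + x) = g x by rewrite subrr mul0r subrr normr0.
  move: E2 b2; rewrite upd_addE upd_upd => E2 b2.
  exact: (implicit_uniq (rBs Bx) b2 b1 E2 E1).
have cg := implicit_continuous Bx.
have gnear e : 0 < e -> \forall h \near (0 : R)^', ball (G x) e (G (h *: basis_vec R l + x)).
  move=> e0; have /continuous_ballP /(_ e e0)[r2 r20 H2] := cg.
  have : \forall h \near (0 : R)^', `|h| < Num.min r2 e.
    by apply: dnbhs0_lt; rewrite lt_min r20.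
  apply: filterS => h; rewrite lt_min => /andP[h2 he].
  have /ball_rVP[_ xh] := inb _ _ he.
  apply/ball_rVP; split => // i; rewrite !updE; case: eqP => [_|_]; last exact: xh.
  by rewrite distrC; apply/H2/inb.
have Hxi (h : R) : exists xi : 'I_n -> 'rV[R]_n, `|h| < r1 -> h != 0 ->
   (forall i i', between (G x 0 i') (G (h *: basis_vec R l + x) 0 i') (xi i 0 i')) /\
   (g (h *: basis_vec R l + x) - g x) / h = - (partial l m (xi l) / partial j m (xi j)).
  have [[hr h0]|nh] := pselect (`|h| < r1 /\ h != 0); last first.
    by exists (fun=> 0) => h1 h2; case: nh.
  have By := H1 _ (inb _ _ hr).
  have bxy (y : 'rV[R]_n) : (forall i', between (G x 0 i') (G (h *: basis_vec R l + x) 0 i') (y 0 i')) ->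
      ball x0 s y by exact: ball_between (implicit_ball Bx) (implicit_ball By).
  have [|xi X1 X2] := @mvt_rV R n m (G x) (G (h *: basis_vec R l + x)).
    by move=> y /bxy By' i; have [] := Ck_is_derive i cm By'.
  exists xi => _ _; split => //.
  move: X2; rewrite /G (Hg Bx).2 (Hg By).2 subrr (bigD1 j) //= (bigD1 l) //= big1 ?addr0; last first.
    move=> i /andP[ij il]; rewrite !updE (negbTE ij) upd_addE updE (negbTE il).
    by rewrite subrr mul0r.
  rewrite !updE !eqxx (negbTE lj) {2}upd_addE updE eqxx [x 0 l + h]addrC addrK => /esym/eqP.
  rewrite addr_eq0 => /eqP E.
  have dj : partial j m (xi j) != 0 by rewrite gt_eqF //; apply/dm/bxy/X1.
  have -> : g (h *: basis_vec R l + x) - g x = - (h * partial l m (xi l)) / partial j m (xi j).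
    by rewrite -E mulfK.
  by field; rewrite dj h0.
have [xi X] := choice Hxi.
have near1 : \forall h \near (0 : R)^', `|h| < r1 /\ h != 0.
  have n1 : \forall h \near (0 : R)^', `|h| < r1 by apply: dnbhs0_lt.
  have n2 : \forall h \near (0 : R)^', h != 0 by exact: nbhs_dnbhs_neq.
  by apply: filterS2 n1 n2.
have cxi i : partial i m (xi h i) @[h --> (0 : R)^'] --> partial i m (G x).
  apply/cvgrPdist_lt => e e0.
  have /continuous_ballP /(_ e e0)[r2 r20 H2] :=
    Ck_continuous (Ck_partial i cm) (implicit_ball Bx).
  apply: filterS2 near1 (gnear _ r20) => h [h1 h0] Hh.
  rewrite distrC; apply: H2; have [X1 _] := X h h1 h0.
  by apply: ball_between (X1 i) => //; exact: ballxx.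
have cl : (fun h : R => h^-1 *: ((g \o shift x) (h *: basis_vec R l) - g x)) @ (0 : R)^'
    --> - (partial l m (G x) / partial j m (G x)).
  have : (fun h : R => - (partial l m (xi h l) / partial j m (xi h j))) @ (0 : R)^'
    --> - (partial l m (G x) / partial j m (G x)).
    apply: cvgN; apply: cvgM; first exact: cxi.
    apply: cvgV; last exact: cxi.
    by rewrite gt_eqF //; apply/dm/implicit_ball.
  apply: cvg_trans; apply: near_eq_cvg.
  apply: filterS near1 => h [h1 h0] /=.
  by have [_ <-] := X h h1 h0; rewrite [RHS]mulrC.
split; last exact: cvg_lim cl.
by apply/cvg_ex; eexists; exact: cl.
Qed.

Lemma Ck_implicit_G i : Ck i (ball x0 r) g ->
  forall l, Ck i (ball x0 r) (fun x => G x 0 l).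
Proof.
move=> cg l; rewrite /G; have [->|lj] := eqVneq l j.
  by apply: Ck_eq cg => [|x _]; [exact: ball_open_rV|rewrite updE eqxx].
apply: Ck_eq (Ck_coord i l (@ball_open_rV n x0 r)) => [|x _]; first exact: ball_open_rV.
by rewrite updE (negbTE lj).
Qed.

(** Bootstrap: if [g] is of class $C^i$ with $i \leq k$, so are [G] and the formula for the partial
    derivatives of [g]; hence [g] is of class $C^{i+1}$. *)
Lemma Ck_implicit : Ck k.+1 (ball x0 r) g.
Proof.
suff H i : (i <= k.+1)%N -> Ck i (ball x0 r) g by exact: H.
elim: i => [_|i IH ik]; first by split => // x; exact: implicit_continuous.
have cg := IH (ltnW ik); have oB := @ball_open_rV n x0 r.
apply: CkS_intro => //; first by move=> x; exact: implicit_continuous.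
move=> l; exists (implicit_partial l); last by move=> x; exact: is_derive_implicit.
have cpm l' : Ck i (ball x0 r) (fun x => partial l' m (G x)).
  apply: Ck_comp (Ck_implicit_G cg) => //; last 2 first.
  - by move=> x; exact: implicit_ball.
  - by apply: Ck_leq (Ck_partial l' cm).
  exact: ball_open_rV.
rewrite /implicit_partial; case: eqP => _; first exact: Ck_cst.
apply: Ck_opp => //; apply: Ck_mul => //; apply: Ck_inv => // x Bx.
by rewrite gt_eqF //; apply/dm/implicit_ball.
Qed.

End Implicit.
End ImplicitFunction.

(** * Elimination of one coordinate *)

Section Elimination.
Variable R : realType.

(** Since [f] is non-negative and [f x = 0], the difference quotient has the sign of [h]; an [h] of
    sign opposite to a nonzero derivative contradicts the limit. *)
Lemma min_partial0 n (U : set 'rV[R]_n) (f : 'rV[R]_n -> R) x j :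
  open U -> U x -> Ck 1 U f -> (forall y, U y -> 0 <= f y) -> f x = 0 ->
  partial j f x = 0.
Proof.
move=> oU Ux cf f0 fx; apply/eqP; rewrite -normr_eq0 -[_ == 0]negbK; apply/negP => l0.
have /is_deriveP /(_ `|partial j f x|) := Ck_is_derive j cf Ux.
rewrite lt_neqAle eq_sym l0 normr_ge0 => /(_ isT)[r r0 Hr].
have [r1 r10 H1] := open_ball_rV oU Ux.
pose h0 := Num.min r r1 / 2.
have h00 : 0 < h0 by rewrite divr_gt0 // lt_min r0.
have hlt : h0 < Num.min r r1 by rewrite ltr_pdivrMr // ltr_pMr ?ltr1n // lt_min r0.
have [hr hr1] : h0 < r /\ h0 < r1 by move: hlt; rewrite lt_min => /andP.
have ff h : `|h| < r1 -> 0 <= f (h *: basis_vec R j + x).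
  move=> hh; apply/f0/H1; rewrite upd_addE; apply: ball_upd; first exact: ballxx.
  by rewrite opprD addrA subrr sub0r normrN.
have [lp|ln] := leP 0 (partial j f x).
  have := Hr (- h0); rewrite oppr_eq0 normrN gt_eqF // gtr0_norm // => /(_ isT hr).
  rewrite fx subr0 (ger0_norm lp) ltr_norml => /andP[+ _].
  rewrite ltNge => /negP; apply; rewrite lerBlDr addNr.
  by rewrite invrN mulrN oppr_le0 divr_ge0 ?(ltW h00) // ff // normrN gtr0_norm.
have := Hr h0; rewrite gt_eqF // gtr0_norm // => /(_ isT hr).
rewrite fx subr0 (ltr0_norm ln) ltr_norml => /andP[_].
rewrite ltNge => /negP; apply; rewrite lerDr.
by rewrite divr_ge0 ?(ltW h00) // ff // gtr0_norm.
Qed.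

(** [S] collects the eliminated coordinates. Any two points of [U] are compared, whether or not a
    path inside [U] along [S] joins them. *)
Definition indep n (S : {set 'I_n}) (U : set 'rV[R]_n) (f : 'rV[R]_n -> R) :=
  forall x y, U x -> U y -> (forall k, k \notin S -> x 0 k = y 0 k) -> f x = f y.

Lemma indep_partial n (S : {set 'I_n}) (U : set 'rV[R]_n) f j : open U ->
  Ck 1 U f -> indep S U f -> indep S U (partial j f).
Proof.
move=> oU cf If x y Ux Uy xy.
suff [_ ] : is_derive x (basis_vec R j) f (partial j f y) by [].
have [r1 r10 H1] := open_ball_rV oU Ux.
have [r2 r20 H2] := open_ball_rV oU Uy.
have /is_deriveP D := Ck_is_derive j cf Uy.
apply/is_deriveP => e e0; have [r r0 Hr] := D e e0.
exists (Num.min r (Num.min r1 r2)); first by rewrite !lt_min r0 r10.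
move=> h h0; rewrite !lt_min => /andP[hr /andP[h1 h2]].
have inb z rho : `|h| < rho -> ball z rho (h *: basis_vec R j + z).
  move=> hh; rewrite upd_addE; apply: ball_upd; first exact/ballxx/le_lt_trans/hh.
  by rewrite opprD addrA subrr sub0r normrN.
rewrite (If _ y Ux Uy xy) (If _ (h *: basis_vec R j + y)); first exact: Hr.
- by apply/H1/inb.
- by apply/H2/inb.
by move=> k /xy E; rewrite mxE [RHS]mxE E.
Qed.

Lemma indep_partial0 n (S : {set 'I_n}) (U : set 'rV[R]_n) f j x : open U ->
  indep S U f -> j \in S -> U x -> partial j f x = 0.
Proof.
move=> oU If jS Ux.
suff [_ ] : is_derive x (basis_vec R j) f 0 by [].
have [r1 r10 H1] := open_ball_rV oU Ux.
apply/is_deriveP => e e0; exists r1 => // h h0 h1.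
rewrite (If _ x) ?subrr ?mul0r ?subrr ?normr0 //.
  apply: H1; rewrite upd_addE; apply: ball_upd; first exact: ballxx.
  by rewrite opprD addrA subrr sub0r normrN.
move=> k kS; rewrite upd_addE updE; case: eqP => // kj.
by move: kS; rewrite kj jS.
Qed.

(** * Splitting off the square of one coordinate *)

Section Pivot.
Variables (n q : nat) (f : 'rV[R]_n -> R) (x0 : 'rV[R]_n) (s : R) (j : 'I_n) (c : R).
Hypothesis s0 : 0 < s.
Hypothesis cf : Ck q.+2 (ball x0 s) f.
Let m := partial j f.
Hypothesis m0 : m x0 = 0.
Hypothesis c0 : 0 < c.
Hypothesis dmc : forall y, ball x0 s y -> c < partial j m y.
Variables (r : R) (g : 'rV[R]_n -> R).
Hypothesis rs : 0 < r <= s.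
Hypothesis Hg : forall x, ball x0 r x -> `|x0 0 j - g x| < s /\ m (upd x j (g x)) = 0.

Let G x := upd x j (g x).
Let B := ball x0 r.
Let oB : open B. Proof. exact: ball_open_rV. Qed.
Let oBs : open (ball x0 s). Proof. exact: ball_open_rV. Qed.
Let cm : Ck q.+1 (ball x0 s) m. Proof. exact: Ck_partial. Qed.
Let dm y : ball x0 s y -> 0 < partial j m y.
Proof. by move=> /dmc; exact: lt_trans. Qed.
Let BBs x : B x -> ball x0 s x.
Proof. by apply: ball_le_rV; case/andP: rs. Qed.

Let cg : Ck q.+1 B g. Proof. exact: (Ck_implicit cm dm rs Hg). Qed.
Let cG l : Ck q.+1 B (fun x => G x 0 l). Proof. exact: Ck_implicit_G cg l. Qed.
Let GB x : B x -> ball x0 s (G x). Proof. exact: (implicit_ball rs Hg). Qed.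
Let Gx0 : G x0 = x0.
Proof. by rewrite /G (implicit_center s0 cm m0 dm rs Hg) upd_id. Qed.
Let Bx0 : B x0. Proof. by apply: ballxx; case/andP: rs. Qed.

Let dg x l : B x -> is_derive x (basis_vec R l) g (implicit_partial m j g l x).
Proof. exact: (is_derive_implicit cm dm rs Hg). Qed.

Let dG x l i : B x -> is_derive x (basis_vec R l) (fun y => G y 0 i)
  (if i == j then implicit_partial m j g l x else (i == l)%:R).
Proof.
move=> Bx; have [->|ij] := eqVneq i j.
  rewrite (_ : (fun y => G y 0 j) = g); first exact: dg.
  by apply/funext => y; rewrite updE eqxx.
rewrite (_ : (fun y => G y 0 i) = fun y : 'rV[R]_n => y 0 i); first exact: is_derive_coord.
by apply/funext => y; rewrite updE (negbTE ij).
Qed.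

Let dcompG (u : 'rV[R]_n -> R) x l : Ck 1 (ball x0 s) u -> B x ->
  is_derive x (basis_vec R l) (fun y => u (G y))
   (implicit_partial m j g l x * partial j u (G x) +
    (if l == j then 0 else partial l u (G x))).
Proof.
move=> cu Bx.
have := @is_derive_chain R n n u G x (basis_vec R l) (ball x0 s) _ oBs (GB Bx)
   (fun y By i => @ex_derive _ _ _ _ _ _ _ (Ck_is_derive i cu By))
   (fun i => Ck_continuous (Ck_partial i cu) (GB Bx)) (fun i => dG l i Bx).
congr is_derive; rewrite (bigD1 j) //= eqxx; congr (_ + _).
have [->|lj] := eqVneq l j.
  by rewrite big1 // => i ij; rewrite (negbTE ij) mul0r.
rewrite (bigD1 l) //= (negbTE lj) eqxx mul1r big1 ?addr0 // => i /andP[ij il].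
by rewrite (negbTE ij) (negbTE il) mul0r.
Qed.

Definition reduced x := f (G x).

(** The chain rule adds a term containing the derivative of [g], but its other factor is
    [m (G x) = 0]. *)
Lemma is_derive_reduced x l : B x ->
  is_derive x (basis_vec R l) reduced (if l == j then 0 else partial l f (G x)).
Proof.
move=> Bx; have := dcompG l (Ck_leq (isT : (1 <= q.+2)%N) cf) Bx.
by congr is_derive; rewrite -/m (Hg Bx).2 mulr0 add0r.
Qed.

Lemma Ck_reduced : Ck q.+2 B reduced.
Proof.
have cfG (u : 'rV[R]_n -> R) : Ck q.+1 (ball x0 s) u -> Ck q.+1 B (fun x => u (G x)).
  by move=> cu; exact: (Ck_comp oB oBs GB cu cG).
apply: CkS_intro => //.
  move=> x Bx; exact: (Ck_continuous (cfG _ (CkW cf)) Bx).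
move=> l; exists (fun x => if l == j then 0 else partial l f (G x)).
  by case: eqP => _; [exact: Ck_cst|exact/cfG/Ck_partial].
by move=> x; exact: is_derive_reduced.
Qed.

Lemma hessianE (u : 'rV[R]_n -> R) x a b : hessian u x a b = partial a (partial b u) x.
Proof. by rewrite mxE. Qed.

(** The formula for the gradient is differentiated once more at [x0], where [G x0 = x0]: for [a]
    other than [j], the derivative of [g] along [a] is [- H a j / H j j] and multiplies [H j b],
    with [H] the Hessian of [f]. *)
Lemma hessian_reduced :
  hessian reduced x0 = hessian f x0 -
    (hessian f x0 j j)^-1 *: (col j (hessian f x0) *m row j (hessian f x0)).
Proof.
have Hjj : hessian f x0 j j != 0.
  by rewrite hessianE gt_eqF // dm //; apply: BBs.
apply/matrixP => a b; rewrite [LHS]hessianE.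
have E : partial a (partial b reduced) x0 =
  'D_(basis_vec R a) (fun x => if b == j then 0 else partial b f (G x)) x0.
  rewrite [LHS]/partial; apply: near_eq_derive.
  have : nbhs x0 B by apply: open_nbhs_nbhs.
  by apply: filterS => x Bx; have [_ <-] := is_derive_reduced b Bx.
have Ef i : partial i (partial b f) x0 = hessian f x0 i b by rewrite hessianE.
have Em i : partial i m x0 = hessian f x0 i j by rewrite hessianE.
have D := dcompG a (Ck_leq (isT : (1 <= q.+1)%N) (Ck_partial b cf)) Bx0.
rewrite E; move: D; rewrite /implicit_partial -/(G x0) Gx0 !Ef !Em => -[_ D].
move: Hjj D; move: (hessian f x0) => H Hjj D.
rewrite !mxE big_ord1 !mxE; have [->|bj] := eqVneq b j.
  by rewrite [LHS]derive_cst [_ * (_ * _)]mulrCA mulVf // mulr1 subrr.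
rewrite D; have [->|aj] := eqVneq a j; first by rewrite mul0r addr0 mulrA mulVf // mul1r subrr.
by rewrite [LHS]addrC mulNr mulrA [_^-1 * _]mulrC.
Qed.

Let pt (t : R) x := upd x j (g x + t * (x 0 j - g x)).

Let pt_ball t x : 0 <= t <= 1 -> B x -> ball x0 s (pt t x).
Proof.
move=> /andP[t0 t1] Bx; apply: ball_upd; first exact: BBs.
have [b _] := Hg Bx; have /ball_rVP[_ /(_ j) b'] := BBs Bx.
apply: between_norm b b' _; rewrite /between minEle maxEle.
by case: (leP (g x) (x 0 j)) => gx; apply/andP; split; nra.
Qed.

(** The integral remainder of Taylor's formula on the segment [pt t x], which runs from [G x] at
    [t = 0] to [x] at [t = 1]. *)
Definition pivot_weight x := int01 (fun t => (1 - t) * partial j m (pt t x)).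

(** [W] and [K] are [pt] and the integrand read as functions of the single row [(t, x)]. Since [t]
    is not confined to [[0, 1]] here, [V'] also requires [W z] to stay in the ball. *)
Let tail_ (z : 'rV[R]_n.+1) : 'rV[R]_n := \row_l z 0 (lift ord0 l).
Let W (z : 'rV[R]_n.+1) := pt (z 0 ord0) (tail_ z).
Let V := [set z : 'rV[R]_n.+1 | B (tail_ z)].
Let V' := [set z : 'rV[R]_n.+1 | B (tail_ z) /\ ball x0 s (W z)].
Let K (z : 'rV[R]_n.+1) := (1 - z 0 ord0) * partial j m (W z).

Let tail_rowcons t x : tail_ (rowcons t x) = x.
Proof. by apply/rowP => l; rewrite mxE rowcons_lift. Qed.

Let tail_ball z e y : ball z e y -> ball (tail_ z) e (tail_ y).
Proof. by move=> /ball_rVP[e0 H]; apply/ball_rVP; split => // k; rewrite !mxE. Qed.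

Let oV : open V.
Proof.
rewrite openE => z Vz; have [e e0 He] := open_ball_rV oB Vz.
by apply/nbhs_ballP; exists e => // y /tail_ball /He.
Qed.

Let ctail l : Ck q.+1 V (fun z => tail_ z 0 l).
Proof.
apply: Ck_eq (Ck_coord q.+1 (lift ord0 l) oV) => // z _; by rewrite mxE.
Qed.

Let cW l : Ck q.+1 V (fun z => W z 0 l).
Proof.
have [->|lj] := eqVneq l j; last first.
  by apply: Ck_eq (ctail l) => // z _; rewrite updE (negbTE lj).
have cgt : Ck q.+1 V (fun z => g (tail_ z)) by exact: (Ck_comp oV oB (fun z Vz => Vz) cg ctail).
apply: (Ck_eq (f := fun z => g (tail_ z) + z 0 ord0 * (tail_ z 0 j - g (tail_ z)))) => //.
  by move=> z _; rewrite updE eqxx.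
apply: Ck_add => //; apply: Ck_mul => //; first exact: Ck_coord.
by apply: Ck_sub => //.
Qed.

Let oV' : open V'.
Proof.
rewrite openE => z [Bz Wz].
have cWz : {for z, continuous W}.
  by apply/continuous_rVP => l; exact: Ck_continuous (cW l) _.
have n1 : nbhs z V by exact: open_nbhs_nbhs.
have n2 : nbhs z (W @^-1` ball x0 s) by apply: cWz; exact: open_nbhs_nbhs.
have : nbhs z V' by apply: filterS2 n1 n2.
by [].
Qed.

Let V'V : V' `<=` V. Proof. by move=> z []. Qed.

Let cK : Ck q V' K.
Proof.
apply: Ck_mul => //.
  by apply: Ck_sub => //; [exact: Ck_cst|exact: Ck_coord].
apply: (Ck_comp (V := ball x0 s) (u := W)) => //.
- by move=> z [].
- exact: Ck_partial.
- by move=> i; apply: Ck_subset V'V _; exact: CkW.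
Qed.

Let BV' x t : B x -> 0 <= t <= 1 -> V' (rowcons t x).
Proof.
by move=> Bx t01; rewrite /V' /W /= tail_rowcons rowcons_0; split => //; exact: pt_ball.
Qed.

Let KE t x : K (rowcons t x) = (1 - t) * partial j m (pt t x).
Proof. by rewrite /K /W tail_rowcons rowcons_0. Qed.

Lemma Ck_pivot_weight : Ck q B pivot_weight.
Proof.
have E x : B x -> int01 (fun t => K (rowcons t x)) = pivot_weight x.
  by move=> _; apply: eq_int01 => t _; rewrite KE.
exact: (Ck_eq oB E (Ck_int01 oB BV' cK)).
Qed.

Let cont_weight x : B x -> cont01 (fun t => (1 - t) * partial j m (pt t x)).
Proof.
move=> Bx; rewrite (_ : (fun t => _) = fun t => K (rowcons t x)); last first.
  by apply/funext => t; rewrite KE.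
by apply: cont01_rowcons => t t01; apply: Ck_continuous cK _; exact: BV'.
Qed.

(** Comparison of integrals is non-strict, hence the uniform lower bound [c] on the second
    derivative: the integral of [1 - t] being 1/2, the weight is at least [c / 2]. *)
Lemma pivot_weight_gt0 x : B x -> 0 < pivot_weight x.
Proof.
move=> Bx.
have cont1 : cont01 (fun t : R => c * (1 - t)).
  move=> t _; apply: cvgM; first exact: cvg_cst.
  by apply: cvgB; [exact: cvg_cst|exact: cvg_id].
have D (t : R) : 0 <= t <= 1 ->
    is_derive t 1 (fun t : R => c * (t - t * t / 2)) (c * (1 - t)).
  move=> _; have D1 : is_derive t 1 (fun s : R => s) 1 by exact: is_derive_id.
  have D2 := is_deriveM D1 D1.
  have D3 := is_deriveB D1 (is_deriveM D2 (is_derive_cst (2^-1 : R) t 1)).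
  have := is_deriveM (is_derive_cst c t 1) D3.
  by congr is_derive; rewrite /GRing.scale /=; rewrite /cst; field.
have E : int01 (fun t : R => c * (1 - t)) = c / 2.
  by rewrite (int01_FTC cont1 D); field.
apply: (@lt_le_trans _ _ (c / 2)); first by rewrite divr_gt0.
rewrite -E; apply: int01_le => //; first exact: cont_weight.
move=> t /[dup] t01 /andP[t0 t1]; rewrite mulrC ler_wpM2l ?subr_ge0 //.
by apply/ltW/dmc/pt_ball.
Qed.

Lemma pivot_identity x : B x -> f x = reduced x + (x 0 j - g x) ^+ 2 * pivot_weight x.
Proof.
move=> Bx; set b := x 0 j - g x.
(* In the derivative of [phi] the two terms [b * m (pt t x)] cancel, which leaves the integrand; and
   [phi 0] is [reduced x] because [m (G x) = 0]. *)
pose phi t := (1 - t) * (b * m (pt t x)) + f (pt t x).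
have aff (t : R) : is_derive t 1 (fun t : R => g x + t * b) b.
  have D1 : is_derive t 1 (fun s : R => s) 1 by exact: is_derive_id.
  have := is_deriveD (is_derive_cst (g x) t 1) (is_deriveM D1 (is_derive_cst b t 1)).
  by congr is_derive; rewrite /GRing.scale /= /cst; ring.
have dpt (u : 'rV[R]_n -> R) (t : R) : Ck 1 (ball x0 s) u -> 0 <= t <= 1 ->
    is_derive t 1 (fun t => u (pt t x)) (partial j u (pt t x) * b).
  move=> cu t01; have D := Ck_is_derive j cu (pt_ball t01 Bx).
  have D' : is_derive (g x + t * b) 1 (fun w => u (upd x j w)) (partial j u (pt t x)).
    exact/is_derive_upd.
  have [d1 d2] := D'; have [d3 d4] := aff t.
  have df : differentiable (fun t : R => g x + t * b) t by apply/derivable1_diffP.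
  have du : differentiable (fun w => u (upd x j w)) (g x + t * b) by apply/derivable1_diffP.
  split.
    by apply/derivable1_diffP; exact: (differentiable_comp df du).
  by rewrite -derive1E (derive1_comp d3 d1) !derive1E d2 d4.
have cfF : Ck 1 (ball x0 s) f by exact: Ck_leq cf.
have cmm : Ck 1 (ball x0 s) m by exact: Ck_leq cm.
have E : int01 (fun t => b ^+ 2 * ((1 - t) * partial j m (pt t x))) = phi 1 - phi 0.
  apply: int01_FTC; first by apply: cont01Z; exact: cont_weight.
  move=> t t01.
  have D1 : is_derive t 1 (fun s : R => s) 1 by exact: is_derive_id.
  have D2 := is_deriveB (is_derive_cst (1 : R) t 1) D1.
  have D3 := is_deriveM (is_derive_cst b t 1) (dpt m t cmm t01).
  have := is_deriveD (is_deriveM D2 D3) (dpt f t cfF t01).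
  congr is_derive; rewrite /GRing.scale /= /cst -/m.
  rewrite -![(_ * _ : _ -> _) _]/(_ * _) -![(_ - _ : _ -> _) _]/(_ - _) /=.
  by ring.
move: E; rewrite int01Z; last exact: cont_weight.
rewrite -/(pivot_weight x) => ->.
have p1 : pt 1 x = x by rewrite /pt mul1r addrC subrK upd_id.
have p0 : pt 0 x = G x by rewrite /pt mul0r addr0.
rewrite /phi p1 p0 /G (Hg Bx).2 /reduced /G; ring.
Qed.

End Pivot.
End Elimination.

(** * One elimination step, and the case where no pivot is left *)

Section EliminationInduction.
Variable R : realType.

(** [a] is $x_j - g$ times the root of the positive weight, so its zeros lie on the graph of [g].
    For the last clause: [f] ignores [S], and so does its derivative along [j]; hence [g], being a
    unique solution, ignores both [S] and [j], and [F] inherits this. *)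
Lemma elim_step n q (f : 'rV[R]_n -> R) x0 (r0 : R) j :
  0 < r0 -> Ck q.+2 (ball x0 r0) f -> (forall x, ball x0 r0 x -> 0 <= f x) ->
  f x0 = 0 -> 0 < hessian f x0 j j ->
  exists (r : R) (g a F : 'rV[R]_n -> R),
   [/\ 0 < r <= r0, Ck q.+2 (ball x0 r) F, Ck q (ball x0 r) a,
       forall x, ball x0 r x -> 0 <= F x & F x0 = 0] /\
   [/\ forall x, ball x0 r x -> f x = a x ^+ 2 + F x,
       forall x : 'rV[R]_n, ball x0 r x -> a x = 0 -> x 0 j = g x,
       hessian F x0 = hessian f x0 -
         (hessian f x0 j j)^-1 *: (col j (hessian f x0) *m row j (hessian f x0)) &
       forall S : {set 'I_n}, indep S (ball x0 r0) f ->
         forall x y : 'rV[R]_n, ball x0 r x -> ball x0 r y ->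
         (forall k, k \notin j |: S -> x 0 k = y 0 k) -> g x = g y /\ F x = F y].
Proof.
move=> r00 cf f0 fx0 Hjj0.
have Hjj : 0 < partial j (partial j f) x0 by rewrite -hessianE.
pose c := partial j (partial j f) x0 / 2.
have c0 : 0 < c by rewrite divr_gt0.
have cH : c < partial j (partial j f) x0 by rewrite ltr_pdivrMr // ltr_pMr // ltr1n.
have Bx0 : ball x0 r0 x0 by exact: ballxx.
have [|s1 s10 Hs1] := continuous_near_ball (P := fun z => c < z)
  (Ck_continuous (Ck_partial j (Ck_partial j cf)) Bx0).
  by apply: open_nbhs_nbhs; split => //; exact: open_gt.
pose s := Num.min r0 s1.
have s0 : 0 < s by rewrite lt_min r00.
have sr0 x : ball x0 s x -> ball x0 r0 x by apply: ball_le_rV; rewrite ge_min lexx.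
have cfs : Ck q.+2 (ball x0 s) f by exact: Ck_subset cf.
have m0 : partial j f x0 = 0.
  by apply: (min_partial0 _ (@ball_open_rV _ _ x0 r0) Bx0) => //; exact: Ck_leq cf.
have dmc y : ball x0 s y -> c < partial j (partial j f) y.
  by move=> xy; apply: Hs1; apply: ball_le_rV xy; rewrite ge_min lexx orbT.
have dm y : ball x0 s y -> 0 < partial j (partial j f) y.
  by move=> /dmc; exact: lt_trans.
have cm := Ck_partial j cfs.
have [r [g [rs Hg]]] := implicit_exists s0 cm m0 dm.
have rBs x : ball x0 r x -> ball x0 s x by apply: ball_le_rV; case/andP: rs.
have oB := @ball_open_rV _ _ x0 r.
pose F := reduced f j g.
pose h := pivot_weight f j g.
have h0 x : ball x0 r x -> 0 < h x by exact: (pivot_weight_gt0 cfs c0 dmc rs Hg).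
exists r, g, (fun x : 'rV[R]_n => (x 0 j - g x) * Num.sqrt (h x)), F; split; split.
- by case/andP: rs => -> /= rs'; apply: le_trans rs' _; rewrite ge_min lexx.
- exact: (Ck_reduced cfs c0 dmc rs Hg).
- apply: Ck_mul => //; last first.
    apply: Ck_sqrt => //; exact: (Ck_pivot_weight cfs c0 dmc rs Hg).
  apply: Ck_sub => //; first exact: Ck_coord.
  by apply: Ck_leq (Ck_implicit cm dm rs Hg).
- by move=> x Bx; apply/f0/sr0; exact: (implicit_ball rs Hg).
- by rewrite /F /reduced (implicit_center s0 cm m0 dm rs Hg) upd_id.
- move=> x Bx; rewrite (pivot_identity cfs c0 dmc rs Hg Bx) addrC; congr (_ + _).
  by rewrite exprMn sqr_sqrtr // ltW // h0.
- move=> x Bx /eqP; rewrite mulf_eq0 sqrtr_eq0 leNgt h0 // orbF subr_eq0.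
  by move/eqP.
- exact: (hessian_reduced s0 cfs m0 c0 dmc rs Hg).
- move=> S IS x y Bx By xy.
  have Im : indep S (ball x0 r0) (partial j f).
    by apply: indep_partial => //; [exact: ball_open_rV|exact: Ck_leq cf].
  have [b1 E1] := Hg _ Bx; have [b2 E2] := Hg _ By.
  have agree k : k \notin S -> upd x j (g x) 0 k = upd y j (g x) 0 k.
    move=> kS; rewrite !updE; case: (eqVneq k j) => // kj.
    by apply: xy; rewrite !inE negb_or kj.
  have Exy : partial j f (upd y j (g x)) = 0.
    rewrite -E1; apply: Im; last by move=> k kS; rewrite agree.
      by apply/sr0/ball_upd => //; exact: rBs.
    by apply/sr0/ball_upd => //; exact: rBs.
  have gxy : g x = g y by exact: (implicit_uniq cm dm (rBs _ By) b1 b2 Exy E2).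
  split => //; rewrite /F /reduced -gxy; apply: IS => //.
    by apply/sr0/ball_upd => //; exact: rBs.
  by apply/sr0/ball_upd => //; exact: rBs.
Qed.

Lemma between_trans (a b c d : R) : between a b c -> between a c d -> between a b d.
Proof.
rewrite /between !minEle !maxEle.
by case: (leP a b) => ? /andP[? ?]; case: (leP a c) => ? /andP[? ?]; apply/andP; split; lra.
Qed.

Lemma between_sqr (a t c : R) : between a (a + t) c -> 0 <= t * (c - a) <= t ^+ 2.
Proof.
rewrite /between minEle maxEle.
by case: (leP a (a + t)) => ? /andP[? ?]; apply/andP; split; nra.
Qed.

Lemma between_dist (a t c : R) : between a (a + t) c -> `|a - c| <= `|t|.
Proof.
rewrite /between minEle maxEle; have := ler_norm t; have := ler_norm (- t).
rewrite normrN => ? ?; rewrite ler_norml.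
by case: (leP a (a + t)) => ? /andP[? ?]; apply/andP; split; lra.
Qed.

(** The mean value theorem, used on [f] and on its derivative. The constant is 1 and not 1/2 because
    the intermediate point is only known to satisfy [0 <= t * (c - x 0 j) <= t ^+ 2]; the lower
    bound here allows the second derivative to be bounded from above only. *)
Lemma taylor_upper n (U : set 'rV[R]_n) (f : 'rV[R]_n -> R) (x : 'rV[R]_n) j (t e : R) :
  Ck 2 U f -> 0 <= e ->
  (forall c, between (x 0 j) (x 0 j + t) c -> U (upd x j c) /\
     partial j (partial j f) (upd x j c) <= e) ->
  f (upd x j (x 0 j + t)) <= f x + t * partial j f x + t ^+ 2 * e.
Proof.
move=> cf e0 H.
have [|c Hc E] := @mvt_coord R n f x j (x 0 j) (x 0 j + t).
  by move=> c /H[Uc _]; have [] := Ck_is_derive j cf Uc.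
have sub c' : between (x 0 j) c c' -> between (x 0 j) (x 0 j + t) c'.
  exact: between_trans Hc.
have [|c' Hc' E'] := @mvt_coord R n (partial j f) x j (x 0 j) c.
  by move=> c' /sub/H[Uc _]; have [] := Ck_is_derive j (Ck_partial j cf) Uc.
have [_ De] := H _ (sub _ Hc').
move: E E'; rewrite upd_id => /eqP; rewrite subr_eq => /eqP -> /eqP; rewrite subr_eq => /eqP ->.
move: De; move: (partial j (partial j f) _) => D De.
have K1 := between_sqr Hc.
case/andP: K1 => K1 K2.
suff : t * ((c - x 0 j) * D) <= t ^+ 2 * e by lra.
rewrite mulrA; apply: (@le_trans _ _ (t * (c - x 0 j) * e)); first exact: ler_wpM2l.
exact: ler_wpM2r.
Qed.

(* If some mixed derivative did not vanish, [f] would be negative at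
   [x0 + h e_a - h sgn(L) e_b] for small [h]; no symmetry of the Hessian is needed. *)
Lemma hess_zero n (U : set 'rV[R]_n) (f : 'rV[R]_n -> R) x0 :
  open U -> U x0 -> Ck 2 U f -> (forall x, U x -> 0 <= f x) -> f x0 = 0 ->
  (forall j, hessian f x0 j j <= 0) -> hessian f x0 = 0.
Proof.
move=> oU Ux0 cf f0 fx0 Hd; apply/matrixP => a b; rewrite hessianE mxE.
apply/eqP; rewrite -[_ == 0]negbK; apply/negP => L0.
set L := partial a (partial b f) x0 in L0.
have L0' : 0 < `|L| by rewrite normr_gt0.
(* Each of the two moves costs at most $h^2 |L|/8$ and the mixed term gains at least $h^2 |L|/2$, so
   the final value is at most $-h^2 |L|/4$. *)
have e0 : 0 < `|L| / 8 by rewrite divr_gt0.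
have near_e i : exists2 s, 0 < s & forall y, ball x0 s y ->
    partial i (partial i f) y < `|L| / 8.
  apply: (continuous_near_ball (P := fun z => z < `|L| / 8)
    (Ck_continuous (Ck_partial i (Ck_partial i cf)) Ux0)).
  apply: open_nbhs_nbhs; split; first exact: open_lt.
  by have := Hd i; rewrite hessianE => /le_lt_trans; apply.
have [sa sa0 Ha] := near_e a; have [sb sb0 Hb] := near_e b.
have [s1 s10 HU] := open_ball_rV oU Ux0.
have e20 : 0 < `|L| / 2 by rewrite divr_gt0.
have /is_deriveP /(_ _ e20)[rho rho0 Hrho] := Ck_is_derive a (Ck_partial b cf) Ux0.
have db0 i : partial i f x0 = 0.
  by apply: (min_partial0 _ oU Ux0) => //; exact: Ck_leq cf.
pose s := Num.min (Num.min sa sb) s1.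
have s0 : 0 < s by rewrite !lt_min sa0 sb0.
(* If [a = b] both moves act on the same coordinate and may add up, hence the requirement
   [2 * h < s]. *)
pose h := Num.min (s / 3) (rho / 2).
have h0 : 0 < h by rewrite lt_min !divr_gt0.
have hs : 2 * h < s.
  have : h <= s / 3 by rewrite ge_min lexx.
  by move=> hs; lra.
have hr : h < rho.
  have : h <= rho / 2 by rewrite ge_min lexx orbT.
  by move=> hr; lra.
have inU y : ball x0 s y -> [/\ U y, partial a (partial a f) y <= `|L| / 8 &
    partial b (partial b f) y <= `|L| / 8].
  move=> xy; split; first by apply: HU; apply: ball_le_rV xy; rewrite ge_min lexx orbT.
    by apply/ltW/Ha; apply: ball_le_rV xy; rewrite !ge_min lexx.
  by apply/ltW/Hb; apply: ball_le_rV xy; rewrite !ge_min lexx !orbT.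
pose y := upd x0 a (x0 0 a + h).
pose sg : R := if 0 < L then -1 else 1.
have sg2 : sg ^+ 2 = 1 by rewrite /sg; case: ifP => _; ring.
have fy : f y <= h ^+ 2 * (`|L| / 8).
  have := @taylor_upper n U f x0 a h (`|L| / 8) cf (ltW e0).
  rewrite fx0 db0 mulr0 !add0r; apply => c /between_dist; rewrite (gtr0_norm h0) => Hc.
  suff /inU[? ? ?] : ball x0 s (upd x0 a c) by [].
  by apply: ball_upd; [exact: ballxx|lra].
have nsg : `|sg * h| = h.
  by rewrite normrM (gtr0_norm h0) /sg; case: ifP; rewrite ?normrN normr1 mul1r.
have yb i : `|x0 0 i - y 0 i| <= h.
  rewrite updE; case: eqP => [->|_]; last by rewrite subrr normr0 ltW.
  by rewrite opprD addrA subrr sub0r normrN gtr0_norm.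
have inb c : `|y 0 b - c| <= h -> ball x0 s (upd y b c).
  move=> Hc; apply/ball_rVP; split => // i; rewrite updE; case: eqP => [->|_]; last first.
    by apply: le_lt_trans (yb i) _; lra.
  apply: le_lt_trans (ler_distD (y 0 b) _ _) _.
  by apply: le_lt_trans hs; rewrite mulr2n mulrDl mul1r lerD.
have fz : f (upd y b (y 0 b + sg * h)) <=
    f y + (sg * h) * partial b f y + (sg * h) ^+ 2 * (`|L| / 8).
  apply: taylor_upper cf (ltW e0) _ => c /between_dist; rewrite nsg => Hc.
  by have [] := inU _ (inb _ Hc).
have fz0 : 0 <= f (upd y b (y 0 b + sg * h)).
  have [|Uz _ _] := inU (upd y b (y 0 b + sg * h)); last exact: f0.
  by apply: inb; rewrite opprD addrA subrr sub0r normrN nsg.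
have := Hrho h; rewrite (gt_eqF h0) (gtr0_norm h0) => /(_ isT hr).
rewrite db0 subr0 upd_addE -/y -/L => HL.
have key : sg * partial b f y <= - (h * (`|L| / 2)).
  move: HL; set P := partial b f y; rewrite ltr_norml => /andP[HL1 HL2].
  have PE : P = P / h * h by rewrite divfK // gt_eqF.
  move: HL1 HL2 PE; set Q := P / h => HL1 HL2 ->.
  rewrite /sg; case: (ltrP 0 L) => L1.
    by move: HL1 HL2; rewrite (gtr0_norm L1) => ? ?; nra.
  by move: HL1 HL2; rewrite (ler0_norm L1) => ? ?; nra.
move: fz; rewrite exprMn sg2 mul1r mulrAC => fz.
have hk : sg * partial b f y * h <= - (h * (`|L| / 2)) * h by rewrite ler_wpM2r // ltW.
have h2 : 0 < h ^+ 2 * `|L| by rewrite mulr_gt0 // exprn_gt0.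
nra.
Qed.

End EliminationInduction.

(** * Elimination until the Hessian vanishes, and local surjectivity *)

Section LocalForm.
Variable R : realType.

Lemma rank_schur n (H : 'M[R]_n) (k : R) j :
  (\rank H <= (\rank (H - k *: (col j H *m row j H))%R).+1)%N.
Proof.
have -> : \rank H = \rank ((H - k *: (col j H *m row j H)) + (k *: col j H) *m row j H)%R.
  by rewrite -scalemxAl subrK.
apply: leq_trans (mxrank_add _ _) _; rewrite -[X in (_ <= X)%N]addn1 leq_add2l.
exact: leq_trans (mxrankM_maxr _ _) (rank_leq_row _).
Qed.

(** Induction on the number of coordinates outside [S], until no diagonal entry of the Hessian is
    positive. Each step eliminates one coordinate and lowers the rank by at most one, whence the
    rank clause. The last two clauses say that, up to the coordinates in [S], the remaining ones
    determine a kernel vector and a zero of [f]: the former serves to project the tangent space, the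
    latter to isolate zeros. Slots [a i] with [i] in [S] are zero so that each pivot finds its own
    slot free. *)
Lemma eliminate n q (f : 'rV[R]_n -> R) x0 (r0 : R) (S : {set 'I_n}) :
  0 < r0 -> Ck q.+2 (ball x0 r0) f -> (forall x, ball x0 r0 x -> 0 <= f x) ->
  f x0 = 0 -> indep S (ball x0 r0) f ->
  exists (S' : {set 'I_n}) (r : R) (a : 'I_n -> 'rV[R]_n -> R) (F : 'rV[R]_n -> R),
   [/\ 0 < r <= r0, forall i, Ck q (ball x0 r) (a i),
       forall i x, i \in S -> a i x = 0,
       forall x, ball x0 r x -> 0 <= F x & indep S' (ball x0 r) F] /\
   [/\ forall x, ball x0 r x -> f x = \sum_i a i x ^+ 2 + F x,
       (\rank (hessian f x0) + #|S| <= #|S'|)%N,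
       forall v : 'rV[R]_n, v *m hessian f x0 = 0 ->
         (forall k, k \notin S' -> v 0 k = 0) -> forall k, k \notin S -> v 0 k = 0 &
       forall x y : 'rV[R]_n, ball x0 r x -> ball x0 r y -> f x = 0 -> f y = 0 ->
         (forall k, k \notin S' -> x 0 k = y 0 k) ->
         forall k, k \notin S -> x 0 k = y 0 k].
Proof.
have [N] := ubnP #|~: S|.
elim: N f r0 S => // N IH f r0 S ltN r00 cf f0 fx0 IS.
have oB := @ball_open_rV R n x0 r0; have Bx0 : ball x0 r0 x0 by exact: ballxx.
have [[j Hjj]|nopivot] := pselect (exists j, 0 < hessian f x0 j j); last first.
  have H0 : hessian f x0 = 0.
    apply: (hess_zero oB Bx0) => //; first exact: Ck_leq cf.
    by move=> j; rewrite leNgt; apply/negP => Hj; apply: nopivot; exists j.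
  move: H0; move: (hessian f x0) => H ->.
  exists S, r0, (fun _ _ => 0), f; split; split => //.
  - by rewrite r00 lexx.
  - by move=> i; exact: Ck_cst.
  - by move=> x _; rewrite big1 ?add0r // => i _; rewrite expr0n.
  - by rewrite mxrank0 add0n.
have I1 i : indep S (ball x0 r0) (partial i f).
  by apply: indep_partial => //; exact: Ck_leq cf.
have Hz i : i \in S -> hessian f x0 i j = 0.
  by move=> iS; rewrite hessianE; exact: (indep_partial0 oB (I1 j) iS Bx0).
have jS : j \notin S by apply/negP => /Hz Hz'; move: Hjj; rewrite Hz' ltxx.
have [r1 [g [a1 [F1 [[r1r0 cF1 ca1 F10 F1x0] [fE a1g HF1 IF1]]]]]] :=
  elim_step r00 cf f0 fx0 Hjj.
have r10 : 0 < r1 by case/andP: r1r0.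
have IjS : indep (j |: S) (ball x0 r1) F1.
  by move=> x y Bx By xy; have [] := IF1 S IS x y Bx By xy.
have ltN' : (#|~: (j |: S)| < N)%N.
  rewrite -ltnS; apply: leq_trans ltN; rewrite ltnS; apply: proper_card.
  by rewrite properC; apply: properUr; rewrite finset.sub1set.
have [S' [r [a [F [[rr1 ca aS F0 IF] [F1E rk ker zer]]]]]] :=
  IH F1 r1 (j |: S) ltN' r10 cF1 F10 F1x0 IjS.
have rB x : ball x0 r x -> ball x0 r1 x by apply: ball_le_rV; case/andP: rr1.
move: HF1 rk ker; move: (hessian F1 x0) => H1 HF1 rk ker.
move: Hjj Hz HF1; move: (hessian f x0) => H Hjj Hz HF1.
exists S', r, (fun i => if i == j then a1 else a i), F; split; split.
- case/andP: rr1 => -> rr1 /=; apply: le_trans rr1 _; by case/andP: r1r0.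
- by move=> i; case: eqP => // _; apply: Ck_subset ca1.
- move=> i x iS; case: eqP => [ij|_]; last by apply: aS; rewrite !inE iS orbT.
  by move: jS; rewrite -ij iS.
- exact: F0.
- exact: IF.
- move=> x Bx; rewrite fE ?F1E; [|exact: Bx|exact: rB].
  rewrite addrA; congr (_ + _); rewrite [RHS](bigD1 j) //= eqxx; congr (_ + _).
  rewrite (bigD1 j) //= aS ?inE ?eqxx // expr0n add0r.
  by apply: eq_bigr => i /negbTE ->.
- move: rk; rewrite HF1 cardsU1 jS => rk.
  apply: leq_trans rk; rewrite add1n addnS -addSn leq_add2r; exact: rank_schur.
- move=> v vH vS'.
  (* [v] annihilates column [j] of [H], hence also the rank-one correction, and lies in the kernel
     of [H1]. *)
  have vk : forall k, k \notin j |: S -> v 0 k = 0.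
    apply: ker vS'; rewrite HF1 mulmxBr vH sub0r -scalemxAr mulmxA colE mulmxA vH.
    by rewrite !mul0mx scaler0 oppr0.
  move=> k kS; have [->|kj] := eqVneq k j; last by apply: vk; rewrite !inE negb_or kj.
  (* This equation reduces to [v 0 j * H j j = 0]: the entries [H i j] with [i] in [S] vanish, and
     [v] is already known to vanish outside [j |: S]. *)
  have : (v *m H) 0 j = 0 by rewrite vH mxE.
  rewrite mxE (bigD1 j) //= big1 ?addr0.
    by move/eqP; rewrite mulf_eq0 (gt_eqF Hjj) orbF => /eqP.
  move=> i ij; have [iS|iS] := boolP (i \in S); first by rewrite Hz // mulr0.
  by rewrite vk ?mul0r // !inE negb_or ij.
- move=> x y Bx By fx fy xy.
  have zz z : ball x0 r z -> f z = 0 -> a1 z = 0 /\ F1 z = 0.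
    move=> Bz; rewrite fE; last exact: rB.
    move=> /eqP; rewrite paddr_eq0 ?sqr_ge0 ?F10 //; last exact: rB.
    by rewrite sqrf_eq0 => /andP[/eqP -> /eqP ->].
  have [ax Fx] := zz _ Bx fx; have [ay Fy] := zz _ By fy.
  have xyk := zer x y Bx By Fx Fy xy.
  move=> k kS; have [->|kj] := eqVneq k j; last by apply: xyk; rewrite !inE negb_or kj.
  rewrite (a1g _ (rB _ Bx) ax) (a1g _ (rB _ By) ay).
  by have [] := IF1 S IS x y (rB _ Bx) (rB _ By) xyk.
Qed.

Lemma rV_mulmx_bound m p (A : 'M[R]_(m, p)) :
  exists2 C : R, 0 < C & forall w : 'rV[R]_m, `|w *m A| <= C * `|w|.
Proof.
exists (1 + \sum_i \sum_j `|A i j|).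
  by rewrite ltr_pwDl // sumr_ge0 // => i _; rewrite sumr_ge0.
move=> w; apply: rV_norm_le.
  by rewrite mulr_ge0 // addr_ge0 // sumr_ge0 // => i _; rewrite sumr_ge0.
move=> k; rewrite mxE; apply: le_trans (ler_norm_sum _ _ _) _.
apply: (@le_trans _ _ (\sum_i `|w| * `|A i k|)).
  by apply: ler_sum => i _; rewrite normrM ler_wpM2r // rV_norm_coord.
rewrite -mulr_sumr mulrC ler_wpM2r //; apply: ler_wpDl => //.
by apply: ler_sum => i _; rewrite (bigD1 k) //= lerDl sumr_ge0.
Qed.

(* Minimise [|Phi u - y|] over a small closed ball; one Newton step from the
   minimiser halves the residual, which must therefore vanish. *)
Lemma loc_surj m (U : set 'rV[R]_m) (Phi : 'rV[R]_m -> 'rV[R]_m) x (e : R) :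
  open U -> U x -> (forall i, Ck 1 U (fun u => Phi u 0 i)) ->
  (\matrix_(l, i) partial l (fun u => Phi u 0 i) x) \in unitmx -> 0 < e ->
  exists2 dl : R, 0 < dl & forall y, `|y - Phi x| < dl ->
    exists2 u, ball x e u & Phi u = y.
Proof.
move=> oU Ux cPhi; set A := \matrix_(l, i) _ => uA e0.
have [C C0 HC] := rV_mulmx_bound (invmx A).
(* A Newton step has length at most [C] times the residual, so a strict error of [(2 * C)^-1] leaves
   at most half of the residual. *)
have eps0 : 0 < (2 * C)^-1 by rewrite invr_gt0 mulr_gt0.
have : forall i, exists r, 0 < r /\ ((forall y, ball x r y -> U y) /\
    forall a b, ball x r a -> ball x r b ->
    `|Phi b 0 i - Phi a 0 i - \sum_l (b 0 l - a 0 l) * partial l (fun u => Phi u 0 i) x|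
      <= (2 * C)^-1 * `|b - a|).
  by move=> i; have [r r0 H] := C1_strict oU Ux (cPhi i) eps0; exists r.
move=> /choice[rr Hrr].
have [r1 r10 HU] := open_ball_rV oU Ux.
pose rho := \big[Num.min/Num.min e r1]_i rr i.
have rho0 : 0 < rho.
  rewrite /rho; elim/big_ind: _ => [|u v u0 v0|i _]; try by rewrite lt_min ?e0 ?u0.
  by have [] := Hrr i.
have rhoi i : rho <= rr i by rewrite /rho; exact: bigmin_le.
have rhoe : rho <= Num.min e r1 by rewrite /rho; exact: bigmin_le_id.
have strict a b : ball x rho a -> ball x rho b ->
    `|Phi b - Phi a - (b - a) *m A| <= (2 * C)^-1 * `|b - a|.
  move=> xa xb; apply: rV_norm_le; first by rewrite mulr_ge0 // ltW.
  move=> i; have [_ [_ H]] := Hrr i.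
  have := H a b (ball_le_rV (rhoi i) xa) (ball_le_rV (rhoi i) xb).
  rewrite !mxE; congr (`| _ - _| <= _); apply: eq_bigr => l _.
  by rewrite !mxE.
have ballP (u : 'rV[R]_m) (s : R) : ball x s u <-> `|x - u| < s.
  by rewrite -ball_normE.
pose rho' := rho / 2.
have rho'0 : 0 < rho' by rewrite divr_gt0.
have rho'r : rho' < rho by rewrite ltr_pdivrMr // ltr_pMr // ltr1n.
pose K := [set u : 'rV[R]_m | `|x - u| <= rho'].
have KB u : K u -> ball x rho u by move=> Ku; apply/ballP; exact: le_lt_trans rho'r.
have cK : compact K.
  apply: bounded_closed_compact.
    exists (`|x| + rho'); split; first by rewrite realD // ?normr_real // gtr0_real.
    move=> M HM u Ku; apply: le_trans (ltW HM); rewrite -[u](subKr x).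
    by apply: le_trans (ler_normB _ _) _; rewrite lerD2l.
  rewrite (_ : K = (fun u => `|x - u|) @^-1` [set t | t <= rho']) //.
  apply: closed_comp; last exact: closed_le.
  move=> u _; apply: (@cvg_norm _ _ _ (nbhs u)).
  by apply: cvgB; [exact: cvg_cst|exact: cvg_id].
have HA (w : 'rV[R]_m) : `|w| <= C * `|w *m A|.
  by have := HC (w *m A); rewrite mulmxK.
(* The minimiser lies within [4 * C * dl] of [x] and the Newton step adds at most [C * dl]; the
   total is [rho'], so the step stays in [K]. *)
pose dl := rho' / (5 * C).
have dl0 : 0 < dl by rewrite divr_gt0 // mulr_gt0.
exists dl => // y ydl.
have K0 : K !=set0 by exists x; rewrite /K /= subrr normr0 ltW.
have cphi u : ball x rho u -> {for u, continuous Phi}.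
  move=> Bu; apply/continuous_rVP => i; apply: Ck_continuous (cPhi i) _.
  by apply: HU; apply: ball_le_rV Bu; apply: le_trans rhoe _; rewrite ge_min lexx orbT.
have [|u uK umin] := EVT_min_rV (f := fun u => `|Phi u - y|) K0 cK.
  apply: continuous_in_subspaceT => u; rewrite inE => /KB/cphi cu.
  apply: (@cvg_norm _ _ _ (nbhs u)).
  by apply: cvgB; [exact: cu|exact: cvg_cst].
rewrite inE in uK.
have xK : K x by rewrite /K /= subrr normr0 ltW.
have Bx : ball x rho x by exact: KB.
have Bu := KB _ uK.
have ux : `|Phi u - y| <= `|y - Phi x|.
  by rewrite [leRHS]distrC; apply: umin; rewrite inE.
exists u; first by apply: ball_le_rV Bu; apply: le_trans rhoe _; rewrite ge_min lexx.
apply/eqP; rewrite -subr_eq0 -normr_eq0; apply/negPn/negP => w0.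
have w0' : 0 < `|Phi u - y| by rewrite lt_neqAle eq_sym w0 normr_ge0.
pose u' := u - (Phi u - y) *m invmx A.
have u'u : `|u' - u| <= C * `|Phi u - y|.
  by rewrite /u' addrAC subrr sub0r normrN.
have ubound : `|u - x| <= 4 * C * `|y - Phi x|.
  have h1 := HA (u - x).
  have h2 := strict _ _ Bx Bu.
  have h3 : `|(u - x) *m A| <= `|Phi u - Phi x| + (2 * C)^-1 * `|u - x|.
    rewrite -[(u - x) *m A](subKr (Phi u - Phi x)).
    by apply: le_trans (ler_normB _ _) _; rewrite lerD2l.
  have h4 : `|Phi u - Phi x| <= 2 * `|y - Phi x|.
    by apply: le_trans (ler_distD y _ _) _; lra.
  have h5 : C * ((2 * C)^-1 * `|u - x|) = `|u - x| / 2 by field; rewrite gt_eqF.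
  have h6 := ler_wpM2l (ltW C0) h3.
  have h7 := ler_wpM2l (ltW C0) h4.
  by rewrite mulrDr h5 in h6; lra.
have dlE : 5 * C * dl = rho' by rewrite /dl mulrC divfK // gt_eqF // mulr_gt0.
have u'K : K u'.
  rewrite /K /= distrC; apply: le_trans (ler_distD u _ _) _.
  have h1 : C * `|Phi u - y| <= C * `|y - Phi x| by rewrite ler_wpM2l // ltW.
  have h2 : 5 * C * `|y - Phi x| <= 5 * C * dl by rewrite ler_wpM2l ?ltW // mulr_gt0.
  by lra.
have := strict _ _ Bu (KB _ u'K).
have -> : Phi u' - Phi u - (u' - u) *m A = Phi u' - y.
  rewrite /u' [u - _ - u]addrAC subrr sub0r mulNmx mulmxKV // opprK.
  by rewrite subrKA.
move=> h1; have := umin u'; rewrite inE => /(_ u'K) h2.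
have h3 : (2 * C)^-1 * `|u' - u| <= `|Phi u - y| / 2.
  have -> : `|Phi u - y| / 2 = (2 * C)^-1 * (C * `|Phi u - y|) by field; rewrite gt_eqF.
  by rewrite ler_wpM2l // ltW.
by lra.
Qed.

End LocalForm.

(** * Local decomposition *)

Section LocalDecomposition.
Variable R : realType.

Lemma indep_set0 n (U : set 'rV[R]_n) (f : 'rV[R]_n -> R) : indep finset.set0 U f.
Proof.
by move=> x y _ _ xy; congr f; apply/rowP => k; apply: xy; rewrite finset.in_set0.
Qed.

Lemma posdef_rank n (H : 'M[R]_n) : posdef H -> \rank H = n.
Proof.
move=> pH; apply/eqP; rewrite -/(row_free H) -kermx_eq0; apply/negPn/negP.
move=> /rowV0Pn[v /sub_kermxP vH v0].
by have := pH v v0; rewrite vH mul0mx mxE ltxx.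
Qed.

(** Full rank forces every coordinate to be eliminated; the last clause of [eliminate] then has no
    remaining coordinate in which two zeros could differ. *)
Lemma posdef_isolated d q (Omega : set 'rV[R]_d) (f : 'rV[R]_d -> R) z :
  open Omega -> Ck q.+2 Omega f -> (forall x, Omega x -> 0 <= f x) ->
  zero_set Omega f z -> posdef (hessian f z) ->
  exists2 e : R, 0 < e & forall y, zero_set Omega f y -> ball z e y -> y = z.
Proof.
move=> oO cf f0 [Oz fz] /posdef_rank rk.
have [r0 r00 rO] := open_ball_rV oO Oz.
have cfr : Ck q.+2 (ball z r0) f by apply: Ck_subset cf => x; exact: rO.
have [S' [r [a [F [[rr0 _ _ _ _] [_ rkS _ zer]]]]]] :=
  eliminate r00 cfr (fun x Bx => f0 _ (rO _ Bx)) fz (@indep_set0 d (ball z r0) f).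
have r_gt0 : 0 < r by case/andP: rr0.
exists r => // y [Oy fy] zy; apply/rowP => k.
apply: (zer y z) => //; [exact: ballxx| |by rewrite finset.in_set0].
move=> i iS'; move: rkS; rewrite rk cards0 addn0 => dS'.
have : (#|S'| < #|'I_d|)%N.
  rewrite -[X in (_ < X)%N]cardsT; apply: proper_card.
  rewrite properE finset.subsetT; apply/negP => /fintype.subsetP /(_ i).
  by rewrite finset.in_setT (negbTE iS') => /(_ isT).
by rewrite card_ord ltnNge dS'.
Qed.

(** Zeros of [f] are minima, so [partial b f (phi v)] vanishes identically on [U]; its derivative in
    direction [l] is entry [(l, b)] of the product. *)
Lemma jacobian_hessian0 d m q (Omega : set 'rV[R]_d) (f : 'rV[R]_d -> R)
  (U : set 'rV[R]_m) (phi : 'rV[R]_m -> 'rV[R]_d) u :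
  open Omega -> Ck q.+2 Omega f -> (forall x, Omega x -> 0 <= f x) ->
  open U -> (forall i, Ck 1 U (fun u => phi u 0 i)) -> U u ->
  (forall v, U v -> zero_set Omega f (phi v)) ->
  (\matrix_(l, i) partial l (fun v => phi v 0 i) u) *m hessian f (phi u) = 0.
Proof.
move=> oO cf f0 oU cphi Uu Uz; apply/matrixP => l b.
have [Ou fu] := Uz u Uu.
have cb : Ck 1 Omega (partial b f) by apply: Ck_leq (Ck_partial b cf).
have D := @is_derive_chain R m d (partial b f) phi u (basis_vec R l) Omega _ oO Ou
   (fun y Oy i => @ex_derive _ _ _ _ _ _ _ (Ck_is_derive i cb Oy))
   (fun i => Ck_continuous (Ck_partial i cb) Ou)
   (fun i => Ck_is_derive l (cphi i) Uu).
have {D} [_ D] := D.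
have E0 : 'D_(basis_vec R l) (fun y => partial b f (phi y)) u = 0.
  rewrite -[RHS](derive_cst (0 : R) u (basis_vec R l)); apply: near_eq_derive.
  have : nbhs u U by exact: open_nbhs_nbhs.
  apply: filterS => v /Uz[Ov fv].
  exact: (min_partial0 b oO Ov (Ck_leq (isT : (1 <= q.+2)%N) cf) f0 fv).
rewrite E0 in D; rewrite mxE [RHS]mxE [RHS]D; apply: eq_bigr => i _.
by rewrite hessianE mxE.
Qed.

Lemma local_sos d q (Omega : set 'rV[R]_d) (f : 'rV[R]_d -> R) x0 :
  open Omega -> Ck q.+2 Omega f -> (forall x, Omega x -> 0 <= f x) ->
  zero_set Omega f x0 -> NHC Omega f x0 ->
  exists (r : R) (a : 'I_d -> 'rV[R]_d -> R),
    [/\ 0 < r, forall x, ball x0 r x -> Omega x,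
        forall i, Ck q (ball x0 r) (a i) &
        forall x, ball x0 r x -> f x = \sum_i a i x ^+ 2].
Proof.
move=> oO cf f0 [Ox0 fx0] [d0 [k [N [[d0d k1 subN Nx0 NZ] rkH]]]].
have [r0 r00 rO] := open_ball_rV oO Ox0.
have cfr : Ck q.+2 (ball x0 r0) f by apply: Ck_subset cf => x; exact: rO.
have [S' [r [a [F [[rr0 ca _ F0 IF] [fE rkS ker _]]]]]] :=
  eliminate r00 cfr (fun x Bx => f0 _ (rO _ Bx)) fx0 (@indep_set0 d (ball x0 r0) f).
have r_gt0 : 0 < r by case/andP: rr0.
have rO' x : ball x0 r x -> Omega x.
  by move=> Bx; apply: rO; apply: ball_le_rV Bx; case/andP: rr0.
have [U [V [phi [psi [[oU U0 oV cphi phi0] [phiU _ _ inj]]]]]] := subN _ Nx0.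
have cphi1 : Ck 1 U phi by exact: Ck_leq cphi.
have cphii i : Ck 1 U (fun u => phi u 0 i) by exact: Ck_component.
have Nphi u : U u -> zero_set Omega f (phi u).
  move=> Uu; apply: NZ; have : (phi @` U) (phi u) by exists u.
  by rewrite phiU => -[].
pose J := \matrix_(l, i) partial l (fun v => phi v 0 i) 0.
have JH : J *m hessian f x0 = 0.
  by rewrite -phi0; exact: (jacobian_hessian0 oO cf f0 oU cphii U0 Nphi).
have dphi (w : 'rV[R]_d0) : w *m J = 0 -> w = 0.
  move=> wJ; apply: inj; rewrite (C1_diff oU U0 cphi1) /mulmxr -/J wJ.
  by rewrite mul0mx.
move: rkH rkS ker JH; move: (hessian f x0) => H rkH rkS ker JH.
pose ev (i : 'I_#|~: S'|) : 'I_d := enum_val i.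
have evS i : ev i \notin S' by have := enum_valP i; rewrite finset.inE.
have evP k' : k' \notin S' -> exists i, ev i = k'.
  move=> kS; have kC : k' \in ~: S' by rewrite finset.inE.
  by exists (enum_rank_in kC k'); rewrite /ev enum_rankK_in.
(* [A] keeps the columns of [J] outside [S']: it is the differential of [phi] followed by the
   projection to the remaining coordinates. The kernel clause makes it injective. *)
pose A := \matrix_(l, i) partial l (fun v => phi v 0 (ev i)) 0.
have fA : row_free A.
  rewrite -kermx_eq0; apply/negPn/negP => /rowV0Pn[w /sub_kermxP wA] /eqP; apply.
  apply: dphi; apply/rowP => i; rewrite [RHS]mxE; apply: (ker (w *m J)).
  - by rewrite -mulmxA JH mulmx0.
  - move=> k' /evP[i' <-].
    have <- : (w *m A) 0 i' = (w *m J) 0 (ev i').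
      by rewrite mxE [RHS]mxE; apply: eq_bigr => l _; rewrite !mxE.
    by rewrite wA mxE.
  - by rewrite finset.in_set0.
(* Injectivity of [A] gives [d0 <= d - #|S'|]; the rank condition and the rank clause give
   [d - d0 <= #|S'|]. So [A] is square and [loc_surj] applies. *)
have dm' : d0 = #|~: S'|.
  have h1 : (d0 <= #|~: S'|)%N by rewrite -(eqP fA); exact: rank_leq_col.
  have h2 := cardsC S'; rewrite card_ord in h2.
  move: rkS; rewrite rkH cards0 addn0 => h3.
  move: h1 h2 h3 d0d; move: #|~: S'| #|S'| => m' s' h1 h2 h3 d0d.
  by clear -h1 h2 h3 d0d; lia.
subst d0.
have uA : A \in unitmx by rewrite -row_free_unit.
pose Phi u : 'rV[R]_(#|~: S'|) := \row_i phi u 0 (ev i).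
have PhiE i : (fun u => Phi u 0 i) = fun u => phi u 0 (ev i).
  by apply/funext => u; rewrite mxE.
have cPhi i : Ck 1 U (fun u => Phi u 0 i) by rewrite PhiE.
have uPhi : (\matrix_(l, i) partial l (fun u => Phi u 0 i) 0) \in unitmx.
  rewrite (_ : \matrix_(l, i) _ = A) //.
  by apply/matrixP => l i; rewrite mxE PhiE [RHS]mxE.
have [e1 e10 He1] := open_ball_rV oU U0.
have cphi0 : {for 0, continuous phi} by exact: Ck_continuous cphi U0.
have /nbhs_ballP[e2 /= e20 He2] : nbhs (0 : 'rV[R]_(#|~: S'|)) (phi @^-1` ball x0 r).
  by apply: cphi0; rewrite phi0; apply: nbhsx_ballx.
have e0 : 0 < Num.min e1 e2 by rewrite lt_min e10.
have [dl dl0 Hdl] := loc_surj oU U0 cPhi uPhi e0.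
exists (Num.min r dl), a; split.
- by rewrite lt_min r_gt0.
- by move=> x Bx; apply: rO'; apply: ball_le_rV Bx; rewrite ge_min lexx.
- move=> i; apply: Ck_subset (ca i) => x; apply: ball_le_rV; by rewrite ge_min lexx.
move=> y xy.
have Br : ball x0 r y by apply: ball_le_rV xy; rewrite ge_min lexx.
have /ball_rVP[_ Bd] : ball x0 dl y by apply: ball_le_rV xy; rewrite ge_min lexx orbT.
(* [F] sees only the coordinates outside [S'], and there [y] agrees with some zero [phi u] of [f],
   at which the sum of squares and [F] both vanish. *)
rewrite fE //; suff -> : F y = 0 by rewrite addr0.
have [|u Bu Pu] := Hdl (\row_i y 0 (ev i)).
  have : ball (Phi 0) dl (\row_i y 0 (ev i)).
    by apply/ball_rVP; split => // i; rewrite !mxE phi0.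
  by rewrite -ball_normE /= distrC.
have Uu : U u by apply: He1; apply: ball_le_rV Bu; rewrite ge_min lexx.
have Bpu : ball x0 r (phi u).
  by apply: (He2 u); apply: ball_le_rV Bu; rewrite ge_min lexx orbT.
have [Opu fpu] := Nphi u Uu.
have -> : F y = F (phi u).
  apply: IF => // k' /evP[i <-].
  by have := congr1 (fun M : 'rV[R]_(#|~: S'|) => M 0 i) Pu; rewrite !mxE.
move: fpu; rewrite fE // => /eqP; rewrite paddr_eq0 ?F0 //; last first.
  by rewrite sumr_ge0 // => i _; exact: sqr_ge0.
by move=> /andP[_ /eqP].
Qed.

End LocalDecomposition.

(** * Gluing *)

Section Gluing.
Variable R : realType.

Lemma esum_eventually0 (I : set nat) (u : nat -> R) N :
  (forall i, 0 <= u i) -> (forall i, ~ I i -> u i = 0) ->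
  (forall i, (N <= i)%N -> u i = 0) ->
  (\esum_(i in I) (u i)%:E = (\sum_(i < N) u i)%:E)%E.
Proof.
move=> u0 uI uN.
have -> : (\esum_(i in I) (u i)%:E = \esum_(i in [set: nat]) (u i)%:E)%E.
  rewrite [LHS]esum_mkcond; apply: eq_esum => i _; case: ifPn => //.
  by rewrite notin_setE => /uI ->.
rewrite (esumID `I_N) => [|i _]; last by rewrite lee_fin.
rewrite [X in (_ + X)%E]esum1 ?adde0; last first.
  by move=> i [_ /= /negP]; rewrite -leqNgt => /uN ->.
rewrite setTI esum_fset //.
- by rewrite -fsbig_ord sumEFin.
- by move=> i _; rewrite lee_fin.
Qed.

Lemma sum_eventually0 (u : nat -> R) N M :
  (forall i, (N <= i)%N -> u i = 0) -> (forall i, (M <= i)%N -> u i = 0) ->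
  \sum_(i < N) u i = \sum_(i < M) u i.
Proof.
wlog NM : N M / (N <= M)%N => [W hN hM|hN _].
  by case: (leqP N M) => [NM|/ltnW MN]; [exact: W|symmetry; exact: W].
rewrite -!(big_mkord xpredT u) [RHS](big_cat_nat (leq0n N) NM) /=.
have -> : \sum_(N <= i < M) u i = 0 by rewrite big_nat big1 // => i /andP[/hN].
by rewrite addr0.
Qed.

Lemma sum_blocks (K N : nat) (v : nat -> R) :
  \sum_(m < N * K) v m = \sum_(n < N) \sum_(i < K) v (n * K + i)%N.
Proof.
elim: N => [|N IH]; first by rewrite mul0n !big_ord0.
by rewrite big_ord_recr /= -IH mulSn addnC big_split_ord.
Qed.

(** Local finiteness takes the form that near each point all indices from some [N] on vanish; every
    sum is then finite, with a bound that can be moved. *)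
Lemma glue_sos d q (Omega : set 'rV[R]_d) (f D : 'rV[R]_d -> R) (I : set nat)
  (u : nat -> 'rV[R]_d -> R) :
  open Omega -> (forall i, Ck q Omega (u i)) ->
  (forall x, Omega x -> exists W N, [/\ open W, W x &
     forall y i, W y -> (N <= i)%N -> u i y = 0]) ->
  Ck q Omega D -> (forall x, Omega x -> 0 < D x) ->
  (forall x N, Omega x -> (forall i, (N <= i)%N -> u i x = 0) ->
     D x * f x = \sum_(i < N) u i x ^+ 2) ->
  (forall i x, ~ I i -> u i x = 0) ->
  SOS_decomp q Omega f I (fun i x => u i x * (Num.sqrt (D x))^-1).
Proof.
move=> oO cu lf cD D0 HD uI; split.
- exact: countableP.
- move=> i _; apply: Ck_mul => //; apply: Ck_inv => //.
    by move=> x Ox; rewrite gt_eqF // sqrtr_gt0 D0.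
  exact: Ck_sqrt.
- move=> x Ox; have [W [N [oW Wx WN]]] := lf x Ox.
  exists W; split => //; apply: (sub_finite_set _ (finite_II N)) => i [_ [y [[Wy _] [_ cly]]]].
  rewrite /= ltnNge; apply/negP => Ni.
  have [z [[_ /eqP uz] Wz]] := cly _ (open_nbhs_nbhs (conj oW Wy)).
  by apply: uz; rewrite (WN z i) // mul0r.
- move=> x Ox; have [W [N [oW Wx WN]]] := lf x Ox.
  have uN i : (N <= i)%N -> u i x = 0 by exact: WN.
  rewrite (@esum_eventually0 _ _ N) //.
  + under eq_bigr do rewrite exprMn.
    rewrite -mulr_suml -HD // exprVn sqr_sqrtr ?ltW ?D0 // mulrAC mulfV ?mul1r //.
    by rewrite gt_eqF // D0.
  + by move=> i; exact: sqr_ge0.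
  + by move=> i /uI ->; rewrite mul0r expr0n.
  + by move=> i /uN ->; rewrite mul0r expr0n.
Qed.

(* A local decomposition of [f] carried by the cut-off function [b]. *)
Definition sos_patch d q K (Omega : set 'rV[R]_d) (f b : 'rV[R]_d -> R)
  (a : 'I_K -> 'rV[R]_d -> R) :=
  [/\ Ck q Omega b, forall x, 0 <= b x,
      forall i, Ck q Omega (fun x => b x * a i x) &
      forall x, Omega x -> b x ^+ 2 * f x = \sum_i (b x * a i x) ^+ 2].

Lemma patch_mul d q K (Omega : set 'rV[R]_d) (f b w : 'rV[R]_d -> R)
  (a : 'I_K -> 'rV[R]_d -> R) : open Omega -> sos_patch q Omega f b a ->
  Ck q Omega w -> (forall x, 0 <= w x) -> sos_patch q Omega f (fun x => w x * b x) a.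
Proof.
move=> oO [cb b0 cba E] cw w0; split.
- exact: Ck_mul.
- by move=> x; rewrite mulr_ge0.
- move=> i; apply: Ck_eq (Ck_mul oO cw (cba i)) => // x _; by rewrite mulrA.
- move=> x Ox; rewrite exprMn -mulrA E // mulr_sumr; apply: eq_bigr => i _.
  by rewrite -exprMn mulrA.
Qed.

(** Function [i] of patch [n] receives the index [n * K.+1 + i], decoded by quotient and
    remainder. *)
Lemma glue_patches d q K (Omega : set 'rV[R]_d) (f : 'rV[R]_d -> R) (I : set nat)
  (b : nat -> 'rV[R]_d -> R) (a : nat -> 'I_K.+1 -> 'rV[R]_d -> R) :
  open Omega -> (forall n, sos_patch q Omega f (b n) (a n)) ->
  (forall x, Omega x -> exists W N, [/\ open W, W x &
     forall y n, W y -> (N <= n)%N -> b n y = 0]) ->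
  (forall x, Omega x -> exists n, b n x != 0) ->
  (forall m x, ~ I m -> b (m %/ K.+1)%N x = 0) ->
  exists fam, SOS_decomp q Omega f I fam.
Proof.
move=> oO pb lf b0 bI.
have /choice[N HN] : forall x, exists N, Omega x -> forall n, (N <= n)%N -> b n x = 0.
  move=> x; have [Ox|nOx] := pselect (Omega x); last by exists 0%N.
  by have [W [N [_ Wx WN]]] := lf x Ox; exists N => _ n; exact: WN.
(* The bound [N x] comes from choice and varies with [x] in an uncontrolled way; [DE] exchanges it
   for any valid bound, in particular one that is constant near a given point. *)
pose D x := \sum_(n < N x) b n x ^+ 2.
have DE x M : Omega x -> (forall n, (M <= n)%N -> b n x = 0) ->
    D x = \sum_(n < M) b n x ^+ 2.
  move=> Ox HM; apply: (sum_eventually0 (u := fun n => b n x ^+ 2)).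
    by move=> n /(HN _ Ox) ->; rewrite expr0n.
  by move=> n /HM ->; rewrite expr0n.
pose u m x := b (m %/ K.+1)%N x * a (m %/ K.+1)%N (inord (m %% K.+1)) x.
exists (fun i x => u i x * (Num.sqrt (D x))^-1); apply: glue_sos => //.
- by move=> m; have [_ _ + _] := pb (m %/ K.+1)%N; exact.
- move=> x Ox; have [W [M [oW Wx WM]]] := lf x Ox.
  exists W, (M * K.+1)%N; split => // y i Wy Mi; rewrite /u WM ?mul0r //.
  by rewrite leq_divRL.
- apply: Ck_local_eq => x Ox; have [W [M [oW Wx WM]]] := lf x Ox.
  exists (W `&` Omega), (fun y => \sum_(n < M) b n y ^+ 2); split => //.
  + exact: openI.
  + apply: Ck_sum; first exact: openI.
    move=> n _; have [cb _ _ _] := pb n.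
    apply: (@Ck_subset _ _ _ _ Omega); first by move=> y [].
    exact: (Ck_mul oO cb cb).
  + by move=> y [Wy Oy]; rewrite (DE y M) // => n; exact: WM.
- move=> x Ox; have [n bn] := b0 x Ox.
  have nN : (n < N x)%N.
    by rewrite ltnNge; apply/negP => /(HN _ Ox) E; rewrite E eqxx in bn.
  rewrite /D (bigD1 (Ordinal nN)) //=; apply: ltr_pwDl.
    by rewrite lt_neqAle sqr_ge0 eq_sym sqrf_eq0 bn.
  by apply: sumr_ge0 => i _; exact: sqr_ge0.
- move=> x M Ox HM.
  have uNx m : (N x * K.+1 <= m)%N -> u m x = 0.
    by rewrite -leq_divRL // => /(HN _ Ox) E; rewrite /u E mul0r.
  rewrite (sum_eventually0 (u := fun m => u m x ^+ 2) (N := M) (M := (N x * K.+1)%N)).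
  + rewrite (sum_blocks K.+1 (N x) (fun m => u m x ^+ 2)) /D mulr_suml.
    apply: eq_bigr => n _; have [_ _ _ ->] := pb n => //.
    apply: eq_bigr => i _; rewrite /u divnMDl // divn_small // addn0.
    by rewrite modnMDl modn_small // inord_val.
  + by move=> m /HM ->; rewrite expr0n.
  + by move=> m /uNx ->; rewrite expr0n.
- by move=> i x Ii; rewrite /u bI // mul0r.
Qed.

(** [h] is arbitrary outside [W]; as [b] vanishes on a whole neighbourhood of each such point, the
    product is locally zero there. *)
Lemma Ck_mul_supp d q (Omega W : set 'rV[R]_d) (b h : 'rV[R]_d -> R) :
  open Omega -> open W -> Ck q Omega b -> Ck q W h ->
  (forall x, Omega x -> ~ W x -> exists V, [/\ open V, V x & forall y, V y -> b y = 0]) ->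
  Ck q Omega (fun x => b x * h x).
Proof.
move=> oO oW cb ch H; apply: Ck_local_eq => x Ox.
have [Wx|nWx] := pselect (W x).
  exists (Omega `&` W), (fun x => b x * h x); split => //; first exact: openI.
  apply: Ck_mul; first exact: openI.
    by apply: Ck_subset cb => y [].
  by apply: Ck_subset ch => y [].
have [V [oV Vx V0]] := H x Ox nWx.
exists V, (fun _ => 0); split => //; first exact: Ck_cst.
by move=> y /V0 ->; rewrite mul0r.
Qed.

(** A product over coordinates because balls are boxes: for [0 < r] it is positive on the ball and
    zero outside. The exponent gives class $C^q$. *)
Definition box_bump d (q : nat) (c : 'rV[R]_d) (r : R) (x : 'rV[R]_d) : R :=
  \prod_i (Num.max 0 (1 - ((x 0 i - c 0 i) / r) ^+ 2)) ^+ q.+1.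

Lemma Ck_bump d q (c : 'rV[R]_d) (r : R) (U : set 'rV[R]_d) : open U -> Ck q U (box_bump q c r).
Proof.
move=> oU; apply: Ck_prod => // i _; apply: Ck_pospow => //.
have cx : Ck q U (fun x => (x 0 i - c 0 i) / r).
  apply: Ck_mul => //; last exact: Ck_cst.
  by apply: Ck_sub => //; [exact: Ck_coord|exact: Ck_cst].
by apply: Ck_sub => //; [exact: Ck_cst|exact: (Ck_mul oU cx cx)].
Qed.

Lemma box_bump_ge0 d q (c : 'rV[R]_d) (r : R) x : 0 <= box_bump q c r x.
Proof. by apply: prodr_ge0 => i _; rewrite exprn_ge0 // le_max lexx. Qed.

Lemma box_bump_center d q (c : 'rV[R]_d) (r : R) : box_bump q c r c = 1.
Proof.
rewrite /box_bump big1 // => i _; rewrite subrr mul0r expr0n subr0 max_r ?ler01 //.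
by rewrite expr1n.
Qed.

Lemma box_bump_factor (r t : R) : 0 < r -> (0 < 1 - (t / r) ^+ 2) = (`|t| < r).
Proof.
move=> r0; rewrite subr_gt0 -real_normK ?num_real // normf_div (gtr0_norm r0).
by rewrite expr_lt1 // ?divr_ge0 ?(ltW r0) // ltr_pdivrMr // mul1r.
Qed.

Lemma box_bump_gt0 d q (c : 'rV[R]_d) (r : R) x : ball c r x -> 0 < box_bump q c r x.
Proof.
move=> /ball_rVP[r0 cx]; apply: prodr_gt0 => i _; rewrite exprn_gt0 // lt_max.
by apply/orP; right; rewrite box_bump_factor // distrC.
Qed.

Lemma box_bump_eq0 d q (c : 'rV[R]_d) (r : R) x : 0 < r -> ~ ball c r x -> box_bump q c r x = 0.
Proof.
move=> r0 ncx.
have [i Hi] : exists i, ~ `|c 0 i - x 0 i| < r.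
  by apply/existsNP => H; apply: ncx; apply/ball_rVP.
rewrite /box_bump (bigD1 i) //= max_l ?expr0n ?mul0r //.
by rewrite leNgt box_bump_factor // distrC; apply/negP.
Qed.

Lemma box_bump_vanish d q (c : 'rV[R]_d) (r rho : R) x : 0 < r -> r < rho -> ~ ball c rho x ->
  forall y, ball x (rho - r) y -> box_bump q c r y = 0.
Proof.
move=> r0 rrho ncx y xy; apply: box_bump_eq0 => // cy; apply: ncx.
by have := ball_triangle cy (ball_sym xy); rewrite addrCA subrr addr0.
Qed.

Lemma patch_bump d q K (Omega : set 'rV[R]_d) (f : 'rV[R]_d -> R)
  (a : 'I_K -> 'rV[R]_d -> R) c (r rho : R) :
  open Omega -> 0 < r -> r < rho ->
  (forall i, Ck q (ball c rho) (a i)) ->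
  (forall x, ball c rho x -> f x = \sum_i a i x ^+ 2) ->
  sos_patch q Omega f (box_bump q c r) a.
Proof.
move=> oO r0 rrho ca fE; split.
- exact: Ck_bump.
- exact: box_bump_ge0.
- move=> i; apply: (@Ck_mul_supp _ _ _ (ball c rho)) => //.
  + exact: ball_open_rV.
  + exact: Ck_bump.
  move=> x Ox ncx; exists (ball x (rho - r)); split; first exact: ball_open_rV.
    by apply: ballxx; rewrite subr_gt0.
  exact: box_bump_vanish.
- move=> x Ox; have [cx|ncx] := pselect (ball c rho x).
    by rewrite fE // mulr_sumr; apply: eq_bigr => i _; rewrite exprMn.
  rewrite (box_bump_vanish q r0 rrho ncx (ballxx x _)) ?subr_gt0 //.
  by rewrite expr0n mul0r big1 // => i _; rewrite mul0r expr0n.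
Qed.

End Gluing.

(** * Countable and finite decompositions *)

Section GlobalDecomposition.
Variables (R : realType) (d q : nat) (Omega : set 'rV[R]_d) (f : 'rV[R]_d -> R).
Hypothesis oO : open Omega.
Hypothesis cf : Ck q.+2 Omega f.
Hypothesis f0 : forall x, Omega x -> 0 <= f x.
Hypothesis nhc : forall x0, zero_set Omega f x0 -> NHC Omega f x0.

Local Notation Z := (zero_set Omega f).

Let cfq : Ck q Omega f. Proof. by apply: Ck_leq cf; rewrite leqW. Qed.

Lemma nonzero_ball x : Omega x -> ~ Z x ->
  exists2 rho, 0 < rho & forall y, ball x rho y -> Omega y /\ 0 < f y.
Proof.
move=> Ox nZx; have [r r0 rO] := open_ball_rV oO Ox.
have fx : 0 < f x.
  by rewrite lt_neqAle f0 // andbT eq_sym; apply/eqP => fx; apply: nZx.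
have [|s s0 Hs] := continuous_near_ball (P := fun t => 0 < t) (Ck_continuous cf Ox).
  by apply: open_nbhs_nbhs; split => //; exact: open_gt.
exists (Num.min r s); first by rewrite lt_min r0.
move=> y xy; split; first by apply: rO; apply: ball_le_rV xy; rewrite ge_min lexx.
by apply: Hs; apply: ball_le_rV xy; rewrite ge_min lexx orbT.
Qed.

(** Pads to a common number of slots: slot 0 holds the root of [f] away from its zeros and is empty
    at a zero, where the functions of [local_sos] fill the others. There is thus a slot for the root
    even when [d = 0]. *)
Lemma local_sos_pad x : Omega x ->
  exists (rho : R) (a : 'I_d.+1 -> 'rV[R]_d -> R),
    [/\ 0 < rho, forall i, Ck q (ball x rho) (a i) &
        forall y, ball x rho y -> f y = \sum_i a i y ^+ 2].
Proof.
move=> Ox; have [Zx|nZx] := pselect (Z x).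
  have [r [a [r0 _ ca fE]]] := local_sos oO cf f0 Zx (nhc Zx).
  exists r, (fun i => if unlift ord0 i is Some k then a k else fun _ => 0); split => //.
    by move=> i; case: (unlift ord0 i) => [k|] //; apply: Ck_cst; exact: ball_open_rV.
  move=> y /fE ->; rewrite big_ord_recl unlift_none expr0n add0r.
  by apply: eq_bigr => i _; rewrite liftK.
have [r r0 Hr] := nonzero_ball Ox nZx.
exists r, (fun i => if i == ord0 then fun y => Num.sqrt (f y) else fun _ => 0); split => //.
  move=> i; case: eqP => _; last by apply: Ck_cst; exact: ball_open_rV.
  apply: Ck_sqrt; first exact: ball_open_rV.
    by move=> y /Hr[].
  by apply: Ck_subset cfq => y /Hr[].
move=> y /Hr[Oy _]; rewrite big_ord_recl eqxx sqr_sqrtr ?f0 // big1 ?addr0 // => i _.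
by rewrite expr0n.
Qed.

Lemma patch0 K : sos_patch q Omega f (fun _ => 0) (fun (_ : 'I_K) _ => 0).
Proof.
split => //; first exact: Ck_cst.
  by move=> i; apply: Ck_eq (Ck_cst q 0 oO) => // x _; rewrite mul0r.
by move=> x _; rewrite expr0n mul0r big1 // => i _; rewrite mul0r expr0n.
Qed.

Lemma Ck_mul_sqrt (b : 'rV[R]_d -> R) : Ck q Omega b ->
  (forall x, Z x -> exists V, [/\ open V, V x & forall y, V y -> b y = 0]) ->
  Ck q Omega (fun x => b x * Num.sqrt (f x)).
Proof.
move=> cb bZ.
pose W := [set x | Omega x /\ 0 < f x].
have oW : open W.
  rewrite openE => x [Ox fx].
  have [|r r0 Hr] := @nonzero_ball x Ox; first by case=> _ E; rewrite E ltxx in fx.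
  by apply/nbhs_ballP; exists r => // y /Hr.
apply: (Ck_mul_supp oO oW cb).
  apply: Ck_sqrt => //; first by move=> x [].
  by apply: Ck_subset cfq => x [].
move=> x Ox nWx; apply: bZ; split => //.
apply/eqP; rewrite eq_le f0 // andbT leNgt; apply/negP => fx; exact: nWx.
Qed.

Lemma patch_sqrt K (b : 'rV[R]_d -> R) : Ck q Omega b -> (forall x, 0 <= b x) ->
  (forall x, Z x -> exists V, [/\ open V, V x & forall y, V y -> b y = 0]) ->
  sos_patch q Omega f b (fun (i : 'I_K.+1) x => if i == ord0 then Num.sqrt (f x) else 0).
Proof.
move=> cb b0 bZ; split => //.
- move=> i; case: (i == ord0); first exact: Ck_mul_sqrt.
  by apply: Ck_eq (Ck_cst q 0 oO) => // x _; rewrite mulr0.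
- move=> x Ox; rewrite big_ord_recl eqxx exprMn sqr_sqrtr ?f0 // big1 ?addr0 //.
  by move=> i _; rewrite mulr0 expr0n.
Qed.

Let rad (k : nat) : R := k.+1%:R^-1.
Let center (c : 'rV[rat]_d) : 'rV[R]_d := \row_i ratr (c 0 i).

(** Pairs [(c, k)] form a countable type. Since [b] is positive on the whole box and not just at
    [x], a patch can be chosen from the box alone. *)
Lemma rational_patch x : Omega x -> exists (c : 'rV[rat]_d) (k : nat),
  ball (center c) (rad k) x /\
  exists b (a : 'I_d.+1 -> 'rV[R]_d -> R), sos_patch q Omega f b a /\
    forall y, ball (center c) (rad k) y -> 0 < b y.
Proof.
move=> Ox; have [rho [a [rho0 ca fE]]] := local_sos_pad Ox.
(* With a radius below [rho / 3], the box of twice that radius around the rational centre still lies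
   in [ball x rho]. *)
have rho30 : 0 < rho / 3 by rewrite divr_gt0.
have [k Hk] := ltr_add_invr rho30; rewrite add0r in Hk.
have k0 : 0 < rad k by rewrite invr_gt0.
have /choice[c Hc] : forall i : 'I_d, exists t : rat, `|ratr t - x 0 i| < rad k.
  move=> i; have [|t] := @rat_in_itvoo R (x 0 i - rad k) (x 0 i + rad k).
    by rewrite ltrBlDr -addrA ltrDl addr_gt0.
  rewrite in_itv/= => /andP[t1 t2]; exists t; rewrite ltr_norml.
  by apply/andP; split; lra.
pose c' : 'rV[rat]_d := \row_i c i.
have cx : ball (center c') (rad k) x.
  by apply/ball_rVP; split => // i; rewrite !mxE.
have sub y : ball (center c') (2 * rad k) y -> ball x rho y.
  move=> cy; have := ball_triangle (ball_sym cx) cy; apply: ball_le_rV.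
  by rewrite -/(rad k) in Hk; lra.
exists c', k; split => //; exists (box_bump q (center c') (rad k)), a; split.
  apply: (patch_bump (rho := 2 * rad k)) => //.
  - by rewrite ltr_pMl // ltr1n.
  - by move=> i; apply: Ck_subset (ca i) => y; exact: sub.
  - by move=> y /sub; exact: fE.
by move=> y; exact: box_bump_gt0.
Qed.

Lemma patch_cover : exists (b : nat -> 'rV[R]_d -> R)
  (a : nat -> 'I_d.+1 -> 'rV[R]_d -> R),
  (forall n, sos_patch q Omega f (b n) (a n)) /\
  (forall x, Omega x -> exists n, 0 < b n x).
Proof.
have H (n : nat) : exists ba : ('rV[R]_d -> R) * ('I_d.+1 -> 'rV[R]_d -> R),
    sos_patch q Omega f ba.1 ba.2 /\
    forall (c : 'rV[rat]_d) (k : nat), unpickle n = Some (c, k) ->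
    (exists b (a : 'I_d.+1 -> 'rV[R]_d -> R), sos_patch q Omega f b a /\
      forall y, ball (center c) (rad k) y -> 0 < b y) ->
    forall y, ball (center c) (rad k) y -> 0 < ba.1 y.
  (* Codes that stand for no box, or for a box carrying no patch, receive the zero patch. *)
  case E : (@unpickle ('rV[rat]_d * nat)%type n) => [[c k]|]; last first.
    by exists (fun _ => 0, fun _ _ => 0); split => //; exact: patch0.
  have [[b [a [pb b0]]]|nb] := pselect (exists b (a : 'I_d.+1 -> 'rV[R]_d -> R),
      sos_patch q Omega f b a /\
      forall y, ball (center c) (rad k) y -> 0 < b y).
    by exists (b, a); split => // c' k' [<- <-].
  exists (fun _ => 0, fun _ _ => 0); split; first exact: patch0.
  by move=> c' k' [<- <-].
have [ba Hba] := choice H.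
exists (fun n => (ba n).1), (fun n => (ba n).2); split.
  by move=> n; have [] := Hba n.
move=> x /rational_patch[c [k [cx ex]]]; exists (pickle (c, k)).
have [_ +] := Hba (pickle (c, k)); apply; last exact: cx.
  by rewrite pickleK.
exact: ex.
Qed.

(* Multiplying by cut-offs of the earlier patches makes an arbitrary countable
   family of patches locally finite: near a point where [b k] is positive, the
   factor of index [k] kills every sufficiently late patch. *)
Lemma sos_countable : exists (I : set nat) (fam : nat -> 'rV[R]_d -> R),
  SOS_decomp q Omega f I fam.
Proof.
have [b [a [pb cov]]] := patch_cover.
pose w n x := \prod_(k < n) (Num.max 0 (rad n - b k x)) ^+ q.+1.
have w0 n x : 0 <= w n x.
  by apply: prodr_ge0 => k _; rewrite exprn_ge0 // le_max lexx.
have b0 n x : 0 <= b n x by have [_ + _ _] := pb n; exact.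
exists setT; apply: (glue_patches (b := fun n x => w n x * b n x) (a := a)) => //.
- move=> n; apply: patch_mul => //; apply: Ck_prod => // k _.
  apply: Ck_pospow => //; apply: Ck_sub => //; first exact: Ck_cst.
  by have [] := pb k.
- move=> x Ox; have [k bk] := cov x Ox.
  have bk2 : b k x / 2 < b k x by rewrite ltr_pdivrMr // ltr_pMr // ltr1n.
  have [cb _ _ _] := pb k.
  have [|r r0 Hr] := continuous_near_ball (P := fun t => b k x / 2 < t) (Ck_continuous cb Ox).
    by apply: open_nbhs_nbhs; split => //; exact: open_gt.
  have [|l Hl] := @ltr_add_invr R 0 (b k x / 2); first by rewrite divr_gt0.
  rewrite add0r in Hl.
  (* [k < n] puts the factor of index [k] into the product, and [l <= n] makes [rad n] smaller than
     [b k x / 2], hence than [b k y]. *)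
  exists (ball x r), (maxn k.+1 l); split; [exact: ball_open_rV|exact: ballxx|].
  move=> y n /Hr by_; rewrite geq_max => /andP[kn ln].
  rewrite /w (bigD1 (Ordinal kn)) //= max_l ?expr0n ?mul0r //.
  rewrite subr_le0; apply: le_trans (ltW by_); apply: le_trans (ltW Hl).
  by rewrite lef_pV2 ?posrE // ler_nat ltnS.
(* At the least [n] with [0 < b n x] all earlier [b k x] are 0, so every factor of [w n x] is a
   power of [rad n]. *)
- move=> x Ox; have ex := cov x Ox.
  have := ex_minnP ex; case: (ex_minnP ex) => n bn nmin _.
  exists n; rewrite mulf_neq0 ?gt_eqF //.
  apply: prodr_gt0 => k _; rewrite exprn_gt0 // lt_max; apply/orP; right.
  suff -> : b k x = 0 by rewrite subr0 invr_gt0.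
  apply/eqP; rewrite eq_le b0 andbT leNgt; apply/negP => /nmin.
  by rewrite leqNgt ltn_ord.
- by move=> m x [].
Qed.

Lemma open_superlevel (b : 'rV[R]_d -> R) c : (forall x, {for x, continuous b}) ->
  open [set y | c < b y].
Proof.
move=> cb; apply: (@open_comp _ _ b [set t | c < t]); last exact: open_gt.
by move=> x _; exact: cb.
Qed.

Lemma sos_compact : compact Z -> exists (I : set nat) (fam : nat -> 'rV[R]_d -> R),
  finite_set I /\ SOS_decomp q Omega f I fam.
Proof.
rewrite compact_cover => cZ.
have /choice[r Hr] : forall z, exists r : R, Z z -> 0 < r /\
    exists a : 'I_d.+1 -> 'rV[R]_d -> R, sos_patch q Omega f (box_bump q z r) a.
  move=> z; have [Zz|nZz] := pselect (Z z); last by exists 0.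
  have [Oz _] := Zz; have [rho [a [rho0 ca fE]]] := local_sos_pad Oz.
  exists (rho / 2) => _; split; first by rewrite divr_gt0.
  exists a; apply: (patch_bump (rho := rho)) => //; first by rewrite divr_gt0.
  by rewrite ltr_pdivrMr // ltr_pMr // ltr1n.
have cbump z s x : {for x, continuous (box_bump q z s : 'rV[R]_d -> R)}.
  exact: (Ck_continuous (Ck_bump q z s openT)).
have [||D DZ covD] := cZ _ Z (fun z => [set y | 2^-1 < box_bump q z (r z) y]).
- by move=> z _; apply: open_superlevel.
- move=> z Zz; exists z => //=; rewrite box_bump_center.
  by rewrite invf_lt1 // ltr1n.
pose s := finmap.enum_fset D; pose m := size s.
have sZ n : (n < m)%N -> Z (nth 0 s n).
  by move=> nm; have := DZ (nth 0 s n) (mem_nth 0 nm); rewrite inE.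
pose bz n := box_bump q (nth 0 s n) (r (nth 0 s n)).
pose B x := \sum_(n < m) bz n x.
(* [c0] vanishes wherever [B] is at least 1/2, hence near every zero, where the root of [f] may fail
   to be regular; it is positive where all the bumps vanish. *)
pose c0 x := (Num.max 0 (2^-1 - B x)) ^+ q.+1.
have B0 x : forall n : 'I_m, bz n x <= B x.
  move=> n; rewrite /B (bigD1 n) //= lerDl sumr_ge0 // => i _; exact: box_bump_ge0.
pose b n := if (n < m)%N then bz n else if n == m then c0 else fun _ => 0.
have H n : exists a : 'I_d.+1 -> 'rV[R]_d -> R, sos_patch q Omega f (b n) a.
  rewrite /b; case: ltnP => nm; first by have [_] := Hr _ (sZ _ nm).
  case: eqP => _; last by eexists; exact: patch0.
  eexists; apply: patch_sqrt.
  - apply: Ck_pospow => //; apply: Ck_sub => //; first exact: Ck_cst.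
    by apply: Ck_sum => // i _; exact: Ck_bump.
  - by move=> x; rewrite exprn_ge0 // le_max lexx.
  - move=> x /covD[z /= zD bzx]; exists [set y | 2^-1 < box_bump q z (r z) y]; split => //.
      exact: open_superlevel.
    move=> y /= bzy; rewrite /c0 max_l ?expr0n // subr_le0.
    have zm : (index z s < m)%N by rewrite index_mem.
    apply: le_trans (ltW bzy) _; apply: le_trans (B0 y (Ordinal zm)).
    by rewrite /bz /= nth_index.
have [a Ha] := choice H.
exists [set i | (i < m.+1 * d.+1)%N].
suff [fam Hfam] : exists fam, SOS_decomp q Omega f [set i | (i < m.+1 * d.+1)%N] fam.
  by exists fam; split => //; exact: finite_II.
have bm n x : (m < n)%N -> b n x = 0.
  by move=> mn; rewrite /b ltnNge (ltnW mn) /= gtn_eqF.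
apply: (glue_patches (b := b) (a := a)) => //.
- move=> x Ox; exists setT, m.+1; split => //; first exact: openT.
  by move=> y n _; exact: bm.
- move=> x Ox; apply: contrapT => nex.
  have bn n : b n x = 0 by apply/eqP/negPn/negP => bn; apply: nex; exists n.
  have := bn m; rewrite /b ltnn eqxx /c0 => /eqP; apply/negP.
  rewrite expf_neq0 // gt_eqF // lt_max; apply/orP; right.
  suff -> : B x = 0 by rewrite subr0 invr_gt0.
  rewrite /B big1 // => n _; have := bn n.
  by rewrite /b ltn_ord.
- by move=> i x /= /negP; rewrite -leqNgt -leq_divRL // => /bm.
Qed.

End GlobalDecomposition.

(** * Strict Hessian condition *)

Section StrictHessian.
Variables (R : realType) (d q : nat) (Omega : set 'rV[R]_d) (f : 'rV[R]_d -> R).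
Hypothesis oO : open Omega.
Hypothesis cf : Ck q.+2 Omega f.
Hypothesis f0 : forall x, Omega x -> 0 <= f x.
Hypothesis nhc : forall x0, zero_set Omega f x0 -> NHC Omega f x0.
Hypothesis strict : forall x0, zero_set Omega f x0 -> posdef (hessian f x0).

Local Notation Z := (zero_set Omega f).

(** The factor 4 is for a path between two zeros through two nearby points: [r z + e + e + r z'] is
    at most [4 * r z] when [e] and [r z'] are at most [r z]. *)
Lemma strict_data : exists (r : 'rV[R]_d -> R) (a : 'rV[R]_d -> 'I_d -> 'rV[R]_d -> R),
  forall z, Z z -> [/\ 0 < r z, forall y, Z y -> ball z (4 * r z) y -> y = z &
    sos_patch q Omega f (box_bump q z (r z)) (a z)].
Proof.
have H z : exists ra : R * ('I_d -> 'rV[R]_d -> R), Z z ->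
  [/\ 0 < ra.1, forall y, Z y -> ball z (4 * ra.1) y -> y = z &
    sos_patch q Omega f (box_bump q z ra.1) ra.2].
  have [Zz|nZz] := pselect (Z z); last by exists (0, fun _ _ => 0).
  have [e e0 He] := posdef_isolated oO cf f0 Zz (strict Zz).
  have [rho [a [rho0 _ ca fE]]] := local_sos oO cf f0 Zz (nhc Zz).
  pose m := Num.min e rho.
  have m0 : 0 < m by rewrite lt_min e0.
  have [me mrho] : m <= e /\ m <= rho by rewrite !ge_min !lexx orbT.
  exists (m / 4, a) => _ /=; split; first by rewrite divr_gt0.
    by move=> y Zy zy; apply: He => //; apply: ball_le_rV zy; lra.
  by apply: (patch_bump (rho := rho)) => //; [rewrite divr_gt0|lra].
have [ra Hra] := choice H.
by exists (fun z => (ra z).1), (fun z => (ra z).2).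
Qed.

Section Disjoint.
Variables (r : 'rV[R]_d -> R).
Hypothesis Hr : forall z, Z z -> 0 < r z /\ forall y, Z y -> ball z (4 * r z) y -> y = z.

Let P z y := Z z /\ ball z (r z) y.

(* The balls of radius [r z] are so small compared with the gaps between zeros
   that every point of [Omega] has a neighbourhood meeting at most one of them. *)
Lemma disjoint_balls x : Omega x -> exists V, [/\ open V, V x &
  forall y y' z z', V y -> V y' -> P z y -> P z' y' -> z = z'].
Proof.
have sep (e : R) y y' z z' : ball x e y -> ball x e y' -> P z y -> P z' y' ->
    r z' <= r z -> e <= r z -> z = z'.
  move=> xy xy' [Zz zy] [Zz' zy'] rr er.
  have [rz0 uz] := Hr Zz; symmetry; apply: uz => //.
  have := ball_triangle (ball_triangle zy (ball_sym xy)) (ball_triangle xy' (ball_sym zy')).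
  by apply: ball_le_rV; lra.
move=> Ox; have [Zx|nZx] := pselect (Z x).
  have [rx0 ux] := Hr Zx.
  exists (ball x (r x)); split; [exact: ball_open_rV|exact: ballxx|].
  have one y z : ball x (r x) y -> P z y -> z = x.
    move=> xy [Zz zy]; have [rz0 uz] := Hr Zz.
    have [le|/ltW le] := leP (r z) (r x).
      apply: ux => //; have := ball_triangle xy (ball_sym zy); apply: ball_le_rV; lra.
    symmetry; apply: uz => //; have := ball_triangle zy (ball_sym xy).
    by apply: ball_le_rV; lra.
  by move=> y y' z z' xy xy' /(one _ _ xy) -> /(one _ _ xy') ->.
have [rho rho0 Hrho] := nonzero_ball oO cf f0 Ox nZx.
pose e := rho / 2.
have e0 : 0 < e by rewrite divr_gt0.
have nb z : Z z -> ~ ball x (2 * e) z.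
  move=> [_ fz] xz; have [|_] := Hrho z; last by rewrite fz ltxx.
  by apply: ball_le_rV xz; rewrite /e; lra.
(* The zero [z] is at distance at least [2 * e] from [x], so its ball needs radius at least [e] to
   reach [ball x e]; this is the last hypothesis of [sep]. *)
have far z y : P z y -> ball x e y -> e <= r z.
  move=> [Zz zy] xy; rewrite leNgt; apply/negP => re; apply: (nb _ Zz).
  have := ball_triangle xy (ball_sym zy); apply: ball_le_rV; lra.
exists (ball x e); split; [exact: ball_open_rV|exact: ballxx|].
move=> y y' z z' xy xy' Pz Pz'.
have [le|/ltW le] := leP (r z') (r z).
  by apply: (sep e y y' z z') => //; exact: far xy.
by symmetry; apply: (sep e y' y z' z) => //; exact: far xy'.
Qed.

End Disjoint.

Lemma sos_strict : exists (I : set nat) (fam : nat -> 'rV[R]_d -> R),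
  I `<=` [set i | (i < d.+1)%N] /\ SOS_decomp q Omega f I fam.
Proof.
have [r [a Hra]] := strict_data.
have Hr z : Z z -> 0 < r z /\ forall y, Z y -> ball z (4 * r z) y -> y = z.
  by case/Hra.
have pa z : Z z -> sos_patch q Omega f (box_bump q z (r z)) (a z) by case/Hra.
pose P z y := Z z /\ ball z (r z) y.
(* [zt y] is the zero whose ball contains [y]; where there is none its value is arbitrary, and [T]
   guards against it by testing [P (zt y) y]. *)
have /choice[zt Hzt] : forall y, exists z, (exists z', P z' y) -> P z y.
  move=> y; have [[z Pz]|nP] := pselect (exists z', P z' y); first by exists z.
  by exists 0 => /nP.
have loc x : Omega x -> exists V z, [/\ open V, V x &
    forall y, V y -> (P (zt y) y -> zt y = z) /\ (P z y -> P (zt y) y)].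
  move=> Ox; have [V [oV Vx Vu]] := disjoint_balls Hr Ox.
  have Pzt y z : P z y -> P (zt y) y by move=> Pz; apply: Hzt; exists z.
  have [[z [y [Vy Pz]]]|nP] := pselect (exists z y, V y /\ P z y).
    exists V, z; split => // y' Vy'; split; last exact: Pzt.
    by move=> Pz'; exact: (Vu y' y).
  exists V, 0; split => // y Vy; split; last exact: Pzt.
  by move=> Py; case: nP; exists (zt y), y.
(* [T h] merges the functions [h z] of all zeros into one. By [disjoint_balls] it coincides, near
   each point of [Omega], with a single product of a bump and [h z], or with 0. *)
pose T (h : 'rV[R]_d -> 'rV[R]_d -> R) y : R :=
  if `[< P (zt y) y >] then box_bump q (zt y) (r (zt y)) y * h (zt y) y else 0.
have TE (h : 'rV[R]_d -> 'rV[R]_d -> R) :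
    (forall z, Z z -> Ck q Omega (fun y => box_bump q z (r z) y * h z y)) ->
    Ck q Omega (T h).
  move=> ch; apply: Ck_local_eq => x Ox; have [V [z [oV Vx HV]]] := loc x Ox.
  exists (V `&` Omega).
  have [Zz|nZz] := pselect (Z z); last first.
    exists (fun _ => 0); split; [exact: openI|by []|exact/Ck_cst/openI|].
    move=> y [Vy _]; rewrite /T; case: asboolP => // Pz.
    by have [/(_ Pz) E _] := HV y Vy; case: nZz; rewrite -E; case: Pz.
  exists (fun y => box_bump q z (r z) y * h z y); split; [exact: openI|by []| |].
    by apply: Ck_subset (ch z Zz) => y [].
  move=> y [Vy _]; rewrite /T; have [h1 h2] := HV y Vy.
  case: asboolP => [/h1 -> //|nP]; rewrite box_bump_eq0 ?mul0r //.
    by have [] := Hr _ Zz.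
  by move=> zy; apply/nP/h2.
pose B := T (fun _ _ => 1).
have cB : Ck q Omega B.
  apply: TE => z Zz; have [cb _ _ _] := pa _ Zz.
  by apply: Ck_eq cb => // y _; rewrite mulr1.
pose U i := T (fun z => a z i).
have cU i : Ck q Omega (U i) by apply: TE => z Zz; have [_ _ + _] := pa _ Zz; exact.
have UB x : Omega x -> B x ^+ 2 * f x = \sum_i U i x ^+ 2.
  move=> Ox; rewrite /B /U /T; case: asboolP => [[Zz _]|_].
    by have [_ _ _] := pa _ Zz; rewrite mulr1; apply.
  by rewrite expr0n mul0r big1 // => i _; rewrite expr0n.
have BZ z : Z z -> B z = 1.
  move=> Zz; have Pz : P z z by split => //; apply: ballxx; have [] := Hr _ Zz.
  have Pzt : P (zt z) z by apply: Hzt; exists z.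
  have E : zt z = z.
    have [Oz _] := Zz; have [V [_ Vz Vu]] := disjoint_balls Hr Oz.
    exact: (Vu z z).
  by rewrite /B /T; case: asboolP => // _; rewrite E box_bump_center mulr1.
(* [B] is 1 at the zeros, so [c0] vanishes near them; where [B] vanishes [c0] is positive, so
   [B x ^+ 2 + c0 x ^+ 2] has no zero in [Omega]. *)
pose c0 x := (Num.max 0 (2^-1 - B x)) ^+ q.+1.
have cc0 : Ck q Omega c0.
  by apply: Ck_pospow => //; apply: Ck_sub => //; exact: Ck_cst.
have ccs : Ck q Omega (fun x => c0 x * Num.sqrt (f x)).
  apply: (Ck_mul_sqrt oO cf f0 cc0) => z Zz; have [Oz _] := Zz.
  have [|s s0 Hs] := continuous_near_ball (P := fun t => 2^-1 < t) (Ck_continuous cB Oz).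
    apply: open_nbhs_nbhs; split; first exact: open_gt.
    by rewrite /= BZ // invf_lt1 // ltr1n.
  exists (ball z s); split; [exact: ball_open_rV|exact: ballxx|].
  by move=> y /Hs By; rewrite /c0 max_l ?expr0n // subr_le0 ltW.
(* Indices below [d] carry the merged functions and index [d] the root of [f], which gives the bound
   [d.+1]. *)
pose u (m : nat) x := if insub m is Some i then U i x else
  if m == d then c0 x * Num.sqrt (f x) else 0.
have ud (m : nat) x : (d < m)%N -> u m x = 0.
  by move=> dm; rewrite /u insubF ?gtn_eqF // ltnNge (ltnW dm).
exists [set i | (i < d.+1)%N].
exists (fun i x => u i x * (Num.sqrt (B x ^+ 2 + c0 x ^+ 2))^-1); split => //.
apply: (@glue_sos R _ _ _ _ (fun x => B x ^+ 2 + c0 x ^+ 2)) => //.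
- move=> m; rewrite /u; case: insub => [i|]; first exact: cU.
  by case: eqP => _; [exact: ccs|exact: Ck_cst].
- move=> x Ox; exists setT, d.+1; split => //; first exact: openT.
  by move=> y i _; exact: ud.
- by apply: Ck_add => //; exact: Ck_mul.
- move=> x Ox; rewrite lt_neqAle addr_ge0 ?sqr_ge0 // andbT eq_sym.
  rewrite paddr_eq0 ?sqr_ge0 // !sqrf_eq0; apply/negP => /andP[/eqP Bx].
  rewrite /c0 Bx subr0; apply/negP; by rewrite expf_neq0 // gt_eqF //.
- move=> x N Ox HN.
  rewrite (sum_eventually0 (u := fun m => u m x ^+ 2) (N := N) (M := d.+1)).
  + rewrite big_ord_recr /= mulrDl UB //; congr (_ + _).
      by apply: eq_bigr => i _; rewrite /u valK.
    by rewrite /u insubF ?ltnn // eqxx exprMn sqr_sqrtr ?f0.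
  + by move=> i /HN ->; rewrite expr0n.
  + by move=> i di; rewrite ud ?expr0n.
- by move=> i x /= /negP; rewrite -leqNgt => /ud.
Qed.

End StrictHessian.

Theorem theorem2p8 (R : realType) (d p : nat) (Omega : set 'rV[R]_d)
  (f : 'rV[R]_d -> R) :
  (2 <= p)%N -> open Omega -> Ck p Omega f ->
  (forall x, Omega x -> 0 <= f x) ->
  (forall x0, zero_set Omega f x0 -> NHC Omega f x0) ->
  [/\ exists (I : set nat) (fam : nat -> 'rV[R]_d -> R),
        SOS_decomp (p - 2) Omega f I fam,
      (forall x0, zero_set Omega f x0 -> posdef (hessian f x0)) ->
        (forall z, zero_set Omega f z -> exists2 e : R, 0 < e &
           forall y, zero_set Omega f y -> ball z e y -> y = z) /\
        exists (I : set nat) (fam : nat -> 'rV[R]_d -> R),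
          I `<=` [set i | (i < d.+1)%N] /\ SOS_decomp (p - 2) Omega f I fam
    & compact (zero_set Omega f) ->
        exists (I : set nat) (fam : nat -> 'rV[R]_d -> R),
          finite_set I /\ SOS_decomp (p - 2) Omega f I fam].
Proof.
case: p => [|[|q]] // _ oO cf f0 nhc; rewrite subn2 /=; split.
- exact: sos_countable oO cf f0 nhc.
- move=> strict; split; last exact: sos_strict oO cf f0 nhc strict.
  by move=> z Zz; exact: posdef_isolated oO cf f0 Zz (strict z Zz).
- exact: sos_compact oO cf f0 nhc.
Qed.
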